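(* Let $\mathcal{O}\subset\mathbb{R}^n$ be a domain, let $\beta\ge 0$ and $-(1+\beta)<\alpha<1$, and let $f\colon\mathcal{O}\to\mathbb{R}$ be uniformly continuous with modulus of continuity $\sigma$ and satisfy $c_0\le f(X)\le c_0^{-1}$ for all $X\in\mathcal{O}$, for some constant $c_0>0$. Let $u_0$ be a bounded limiting solution of $$u_0^\alpha\,|Du_0|^\beta\,\Delta u_0=f(X)\,\chi_{\{u_0>0\}}\quad\text{in }\mathcal{O}.$$ Fix a subdomain $\mathcal{O}'\Subset\mathcal{O}$. Then there exists a constant $C\ge 1$, depending only on $n$, $\|u_0\|_{L^\infty(\mathcal{O})}$, $\alpha$, $\beta$, $c_0$, $\sigma$ and $\mathrm{dist}(\partial\mathcal{O}',\partial\mathcal{O})$, such that if $Z\in\partial\{u_0>0\}\cap\mathcal{O}'$, then $$\sup_{B_r(Z)}u_0\le C\,r^{\frac{2+\beta}{1+\beta+\alpha}}$$ for any $0<r<\mathrm{dist}(Z,\partial\mathcal{O}')$.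
   Context: A modulus of continuity is a nondecreasing function $\sigma\colon(0,\infty)\to(0,\infty)$ with $\sigma(0^+)=0$; $f$ has modulus of continuity $\sigma$ if $|f(X)-f(Y)|\le\sigma(|X-Y|)$ for all distinct $X,Y\in\mathcal{O}$. $\mathcal{O}'\Subset\mathcal{O}$ means that the closure of $\mathcal{O}'$ is compact and contained in $\mathcal{O}$; $B_r(Z)$ is the open ball of radius $r$ centered at $Z$; $\chi_A$ is the indicator function of $A$. Limiting solution: a nonnegative function $u_0\in C(\mathcal{O})$ is a limiting solution of $u_0^\alpha|Du_0|^\beta\Delta u_0=f(X)\chi_{\{u_0>0\}}$ in $\mathcal{O}$ if there exists a sequence of positive functions $u_j$ satisfying $u_j^\alpha|Du_j|^\beta\Delta u_j=f(X)$ in $\mathcal{O}$ in the viscosity sense and converging locally uniformly to $u_0$ in $\mathcal{O}$. Viscosity solutions are understood in the usual sense: a continuous positive function $u$ satisfies $u^\alpha|Du|^\beta\Delta u=f$ in $\mathcal{O}$ in the viscosity sense if, whenever $\varphi$ is $C^2$ near $X_0\in\mathcal{O}$ and $u-\varphi$ has a local maximum (respectively, local minimum) at $X_0$, one has $u(X_0)^\alpha|D\varphi(X_0)|^\beta\Delta\varphi(X_0)\ge f(X_0)$ (respectively, $\le f(X_0)$). When $\beta=0$ the factor $|D\varphi|^\beta$ is equal to $1$. *)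

(* Defs.v *)
From HB Require Import structures.
From mathcomp Require Import all_boot all_order all_algebra.
From mathcomp Require Import all_classical all_reals all_analysis.
Import numFieldNormedType.Exports.
Set Implicit Arguments.
Unset Strict Implicit.
Unset Printing Implicit Defensive.
Import Order.TTheory GRing.Theory Num.Theory.
Local Open Scope classical_set_scope.
Local Open Scope ring_scope.

(* R^n is 'rV[R]_n. Its library norm is the sup norm, which induces the usual
   topology, so open, compact, closure and continuity are the library notions.
   The Euclidean norm, balls and distances are defined separately below. *)

Definition enorm (R : realType) (n : nat) (x : 'rV[R]_n) : R :=
  Num.sqrt (\sum_(i < n) x ord0 i ^+ 2).

Definition eball (R : realType) (n : nat) (Z : 'rV[R]_n) (r : R) :
    set 'rV[R]_n :=
  [set X | enorm (X - Z) < r].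

(* The distance to an empty set is +oo. *)
Definition set_dist (R : realType) (n : nat) (A B : set 'rV[R]_n) : \bar R :=
  ereal_inf [set (enorm (X - Y))%:E | X in A & Y in B].

Definition boundary (T : topologicalType) (A : set T) : set T :=
  closure A `\` A°.

Definition domain (T : topologicalType) (O : set T) : Prop :=
  [/\ open O, connected O & O !=set0].

Definition compactly_contained (T : topologicalType) (O' O : set T) : Prop :=
  compact (closure O') /\ closure O' `<=` O.

(* Only the values of sigma on (0, +oo) matter. *)
Definition modulus_of_continuity (R : realType) (sigma : R -> R) : Prop :=
  [/\ forall t, 0 < t -> 0 < sigma t,
      forall s t, 0 < s -> s <= t -> sigma s <= sigma t
    & sigma t @[t --> 0^'+] --> 0].

Definition has_modulus (R : realType) (n : nat) (O : set 'rV[R]_n)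
    (sigma : R -> R) (f : 'rV[R]_n -> R) : Prop :=
  forall X Y, O X -> O Y -> X <> Y -> `|f X - f Y| <= sigma (enorm (X - Y)).

(* For functions continuous on an open set O this is the L^oo(O) norm. *)
Definition sup_norm (R : realType) (n : nat) (O : set 'rV[R]_n)
    (u : 'rV[R]_n -> R) : \bar R :=
  ereal_sup [set `|u X|%:E | X in O].

Definition partial (R : realType) (n : nat) (i : 'I_n) (phi : 'rV[R]_n -> R) :
    'rV[R]_n -> R :=
  fun X => 'D_(delta_mx ord0 i) phi X.

Definition gradient (R : realType) (n : nat) (phi : 'rV[R]_n -> R)
    (X : 'rV[R]_n) : 'rV[R]_n :=
  \row_(i < n) partial i phi X.

Definition laplacian (R : realType) (n : nat) (phi : 'rV[R]_n -> R)
    (X : 'rV[R]_n) : R :=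
  \sum_(i < n) partial i (partial i phi) X.

Definition C1_on (R : realType) (n : nat) (U : set 'rV[R]_n)
    (phi : 'rV[R]_n -> R) : Prop :=
  forall i : 'I_n,
    (forall X, U X -> derivable phi X (delta_mx ord0 i)) /\
    {within U, continuous (partial i phi)}.

Definition C2_on (R : realType) (n : nat) (U : set 'rV[R]_n)
    (phi : 'rV[R]_n -> R) : Prop :=
  C1_on U phi /\ forall i : 'I_n, C1_on U (partial i phi).

Definition C2_near (R : realType) (n : nat) (X0 : 'rV[R]_n)
    (phi : 'rV[R]_n -> R) : Prop :=
  exists U : set 'rV[R]_n, [/\ open U, U X0 & C2_on U phi].

Definition local_max (R : realType) (T : topologicalType) (g : T -> R)
    (X0 : T) : Prop :=
  \forall X \near X0, g X <= g X0.

Definition local_min (R : realType) (T : topologicalType) (g : T -> R)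
    (X0 : T) : Prop :=
  \forall X \near X0, g X0 <= g X.

(* u^alpha |Du|^beta Lap u = f in O; the library's convention 0 `^ 0 = 1 makes
   the gradient factor equal to 1 when beta = 0. *)
Definition viscosity_solution (R : realType) (n : nat) (alpha beta : R)
    (f : 'rV[R]_n -> R) (O : set 'rV[R]_n) (u : 'rV[R]_n -> R) : Prop :=
  [/\ {within O, continuous u},
      forall X, O X -> 0 < u X,
      forall X0 phi, O X0 -> C2_near X0 phi ->
        local_max (fun X => u X - phi X) X0 ->
        f X0 <= u X0 `^ alpha * enorm (gradient phi X0) `^ beta
                * laplacian phi X0
    & forall X0 phi, O X0 -> C2_near X0 phi ->
        local_min (fun X => u X - phi X) X0 ->
        u X0 `^ alpha * enorm (gradient phi X0) `^ beta * laplacian phi X0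
          <= f X0].

Definition positivity_set (R : realType) (n : nat) (O : set 'rV[R]_n)
    (u : 'rV[R]_n -> R) : set 'rV[R]_n :=
  [set X | O X /\ 0 < u X].

(* Locally uniform convergence in O is uniform convergence on the compact
   subsets of O, R^n being locally compact. *)
Definition limiting_solution (R : realType) (n : nat) (alpha beta : R)
    (f : 'rV[R]_n -> R) (O : set 'rV[R]_n) (u0 : 'rV[R]_n -> R) : Prop :=
  [/\ {within O, continuous u0},
      forall X, O X -> 0 <= u0 X
    & exists u : nat -> 'rV[R]_n -> R,
        (forall j, viscosity_solution alpha beta f O (u j)) /\
        {family [set K | compact K /\ K `<=` O], u @ \oo --> u0}].

(* Main.v *)
Require Import Defs.
From HB Require Import structures.
From mathcomp Require Import all_boot all_order all_algebra.
From mathcomp Require Import all_classical all_reals all_analysis.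
From mathcomp Require Import ring lra.
From mathcomp Require mpoly.
Import -(notations) mpoly.
Import numFieldNormedType.Exports.
Set Implicit Arguments.
Unset Strict Implicit.
Unset Printing Implicit Defensive.
Import Order.TTheory GRing.Theory Num.Theory.
Local Open Scope classical_set_scope.
Local Open Scope ring_scope.

(** Growth at the free boundary follows from a Harnack inequality of flat type,
    proved by comparison with polynomials only.

    Let [g = (2 + beta) / (1 + beta + alpha)]; it exceeds 1 because [alpha < 1].
    Suppose a positive solution [u] is at most [S] on a ball of radius [r], with
    [S] much larger than [r `^ g].  Rescaled to the unit ball, [w = u / S] and
    [v = w `^ (1 / g)] satisfy [0 < w <= v <= 1], and the equation yields two
    one-sided facts.  First, [w] is subharmonic, because [f] is positive.
    Second, [v] solves [|Dv| ^ beta * (v * Lap v + (g - 1) * |Dv| ^ 2) = F] with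
    [F] small, so [v] is superharmonic wherever it is touched from below with a
    slope above a small threshold ([rescaled_superharmonic]).  The power [1 / g]
    is chosen so that the value of [v] drops out of this second fact; it holds
    near the zeros as well as elsewhere, whatever the sign of [alpha].

    These two facts alone make [w] small on the ball of radius 1/4 as soon as
    [v] is small at the centre ([small_near_zero]).  The main step is the
    estimate [w x <= v y + L * |x - y|] with [L] depending on the dimension only
    ([lipschitz_comparison]).  It is proved by doubling the variables and
    coupling the two points by reflection; the inequality [w <= v] is what puts
    the maximum off the diagonal.  If now [w] were large at a point, [v] would be
    large on a ball around it, and a radial barrier without critical points would
    carry a positive lower bound for [v] to the centre.

    Doubling needs a sub- and a superharmonic function to be subtracted in the
    viscosity sense.  As only the Laplacian occurs, the general theorem on sums
    is replaced by [strict_touching_sub_super]: on a small ball the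
    superharmonic function is compared with a harmonic polynomial having almost
    the same values on the sphere ([harmonic_approx]).  Such a polynomial is
    obtained from Bernstein's approximation theorem and from the solvability of
    the Dirichlet problem on a ball for polynomial data, which is linear algebra
    ([dirichlet_mpoly]).  For [v] to be superharmonic on a whole neighbourhood of
    the maximum its slopes must be controlled there; for this [v] is first
    replaced by its inf-convolution ([inf_convolution_steep]).

    Passing to the limit in the approximating solutions gives, at a zero [Z] of
    [u0], the decay [sup u0 <= (1 / 4) `^ g * S] from each ball about [Z] to the
    one of a quarter of its radius, unless [S] is already of the size of
    [r `^ g]; iterating it gives the growth rate.  The first radius depends on
    the distance of the two boundaries only, since a segment from [Z] to the
    complement of the domain crosses both of them. *)

(** * Euclidean geometry *)

Definition dot (R : realType) (n : nat) (x y : 'rV[R]_n) : R :=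
  \sum_(i < n) x ord0 i * y ord0 i.

Lemma dotC (R : realType) n (x y : 'rV[R]_n) : dot x y = dot y x.
Proof. by apply: eq_bigr => i _; rewrite mulrC. Qed.

Lemma dotDl (R : realType) n (x y z : 'rV[R]_n) :
  dot (x + y) z = dot x z + dot y z.
Proof. by rewrite -big_split; apply: eq_bigr => i _; rewrite mxE mulrDl. Qed.

Lemma dotZl (R : realType) n (a : R) (x y : 'rV[R]_n) :
  dot (a *: x) y = a * dot x y.
Proof. by rewrite mulr_sumr; apply: eq_bigr => i _; rewrite mxE mulrA. Qed.

Lemma dotNl (R : realType) n (x y : 'rV[R]_n) : dot (- x) y = - dot x y.
Proof. by rewrite -scaleN1r dotZl mulN1r. Qed.

Lemma dotBl (R : realType) n (x y z : 'rV[R]_n) :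
  dot (x - y) z = dot x z - dot y z.
Proof. by rewrite dotDl dotNl. Qed.

Lemma dotDr (R : realType) n (x y z : 'rV[R]_n) :
  dot x (y + z) = dot x y + dot x z.
Proof. by rewrite dotC dotDl !(dotC x). Qed.

Lemma dotZr (R : realType) n (a : R) (x y : 'rV[R]_n) :
  dot x (a *: y) = a * dot x y.
Proof. by rewrite dotC dotZl dotC. Qed.

Lemma dotNr (R : realType) n (x y : 'rV[R]_n) : dot x (- y) = - dot x y.
Proof. by rewrite dotC dotNl dotC. Qed.

Lemma dotBr (R : realType) n (x y z : 'rV[R]_n) :
  dot x (y - z) = dot x y - dot x z.
Proof. by rewrite dotDr dotNr. Qed.

Definition dotE := (dotDl, dotDr, dotNl, dotNr, dotZl, dotZr).

Lemma dot_ge0 (R : realType) n (x : 'rV[R]_n) : 0 <= dot x x.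
Proof. by apply: sumr_ge0 => i _; rewrite -expr2 sqr_ge0. Qed.

Lemma enorm_ge0 (R : realType) n (x : 'rV[R]_n) : 0 <= enorm x.
Proof. exact: sqrtr_ge0. Qed.

Lemma enormE (R : realType) n (x : 'rV[R]_n) : enorm x = Num.sqrt (dot x x).
Proof.
by rewrite /enorm; congr Num.sqrt; apply: eq_bigr => i _; rewrite expr2.
Qed.

Lemma enorm_sqr (R : realType) n (x : 'rV[R]_n) : enorm x ^+ 2 = dot x x.
Proof. by rewrite enormE sqr_sqrtr // dot_ge0. Qed.

Lemma enorm0 (R : realType) n : enorm (0 : 'rV[R]_n) = 0.
Proof. by rewrite enormE -(scale0r 0) dotZl mul0r sqrtr0. Qed.

Lemma enormZ (R : realType) n (a : R) (x : 'rV[R]_n) :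
  enorm (a *: x) = `|a| * enorm x.
Proof.
by rewrite !enormE dotZl dotZr mulrA -expr2 sqrtrM ?sqr_ge0 // sqrtr_sqr.
Qed.

Lemma enormN (R : realType) n (x : 'rV[R]_n) : enorm (- x) = enorm x.
Proof. by rewrite -scaleN1r enormZ normrN1 mul1r. Qed.

Lemma enorm_distC (R : realType) n (x y : 'rV[R]_n) :
  enorm (x - y) = enorm (y - x).
Proof. by rewrite -enormN opprB. Qed.

Lemma coord_le_enorm (R : realType) n (x : 'rV[R]_n) i :
  `|x ord0 i| <= enorm x.
Proof.
rewrite -(ler_pXn2r (ltn0Sn 1)) ?nnegrE ?enorm_ge0 // enorm_sqr real_normK ?num_real //.
by rewrite /dot (bigD1 i) //= -expr2 lerDl sumr_ge0 // => j _; rewrite -expr2 sqr_ge0.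
Qed.

Lemma enorm_eq0 (R : realType) n (x : 'rV[R]_n) : enorm x = 0 -> x = 0.
Proof.
move=> x0; apply/rowP => i; rewrite mxE; apply/eqP.
by rewrite -normr_le0 -x0 coord_le_enorm.
Qed.

Lemma enorm_gt0 (R : realType) n (x : 'rV[R]_n) : x != 0 -> 0 < enorm x.
Proof.
by move=> x0; rewrite lt_def enorm_ge0 andbT; apply: contra x0 => /eqP/enorm_eq0->.
Qed.

Lemma cauchy_schwarz (R : realType) n (x y : 'rV[R]_n) :
  dot x y <= enorm x * enorm y.
Proof.
have [->|y0] := eqVneq y 0.
  by rewrite enorm0 mulr0 -(scale0r 0) dotZr mul0r.
have y_gt0 := enorm_gt0 y0.
have := dot_ge0 (enorm y *: x - (enorm x) *: y).
rewrite !dotE -!enorm_sqr (dotC y x) => h.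
have {}h : enorm x * enorm y * dot x y <= (enorm x * enorm y) ^+ 2 by lra.
have [->|x0] := eqVneq x 0; first by rewrite enorm0 mul0r -(scale0r 0) dotZl mul0r.
by move: h; rewrite expr2 ler_pM2l // mulr_gt0 // enorm_gt0.
Qed.

Lemma enormD (R : realType) n (x y : 'rV[R]_n) :
  enorm (x + y) <= enorm x + enorm y.
Proof.
rewrite -(ler_pXn2r (ltn0Sn 1)) ?nnegrE ?addr_ge0 ?enorm_ge0 //.
rewrite sqrrD !enorm_sqr !dotE (dotC y x).
have := cauchy_schwarz x y; lra.
Qed.

Lemma enorm_triangle (R : realType) n (x y z : 'rV[R]_n) :
  enorm (x - z) <= enorm (x - y) + enorm (y - z).
Proof. by apply: le_trans (enormD _ _); rewrite addrA subrK. Qed.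

Lemma enorm_le_norm (R : realType) n (x : 'rV[R]_n) :
  enorm x <= n%:R * `|x|.
Proof.
have h : dot x x <= (n%:R * `|x|) ^+ 2.
  have -> : (n%:R * `|x|) ^+ 2 = \sum_(i < n) n%:R * `|x| ^+ 2.
    by rewrite sumr_const card_ord -[RHS]mulr_natl exprMn expr2 mulrA.
  apply: ler_sum => i _; rewrite -expr2 -(real_normK (num_real _)).
  have xi : `|x ord0 i| <= `|x|.
    rewrite {2}/Num.norm /= mx_normrE.
    exact: (le_bigmax _ (fun ij => `|x ij.1 ij.2|) (ord0, i)).
  have n1 : (1 : R) <= n%:R by rewrite ler1n; case: (n) i {xi} => [[]|].
  have : `|x ord0 i| ^+ 2 <= `|x| ^+ 2 by rewrite lerXn2r ?nnegrE.
  have := sqr_ge0 `|x|; nra.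
by rewrite enormE -(@ger0_norm _ (n%:R * `|x|)) ?mulr_ge0 // -sqrtr_sqr ler_wsqrtr.
Qed.

Lemma norm_le_enorm (R : realType) n (x : 'rV[R]_n) : `|x| <= enorm x.
Proof.
rewrite {1}/Num.norm /= mx_normrE; apply: bigmax_le; first exact: enorm_ge0.
by move=> [i j] _ /=; rewrite ord1 coord_le_enorm.
Qed.

(** The topology comes from the sup norm; this is the bridge that lets every
    local statement below be made with Euclidean balls. *)
Lemma nbhs_enormP (R : realType) n (x : 'rV[R]_n) (A : set 'rV[R]_n) :
  nbhs x A <-> exists2 e : R, 0 < e & forall y, enorm (y - x) < e -> A y.
Proof.
split.
  rewrite -nbhs_nbhs_norm => -[e /= e0 eA]; exists e => // y yx; apply: eA => /=.
  by rewrite distrC; apply: le_lt_trans yx; exact: norm_le_enorm.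
move=> [e e0 eA]; rewrite -nbhs_nbhs_norm; exists (e / n.+1%:R); rewrite /= ?divr_gt0 //.
move=> y /= yx; apply: eA; apply: le_lt_trans (enorm_le_norm _) _.
rewrite distrC; move: yx; rewrite ltr_pdivlMr // mulrC => /(le_lt_trans _); apply.
by rewrite ler_wpM2r // ler_nat.
Qed.

Lemma continuous_enormP (R : realType) n (f : 'rV[R]_n -> R) (x : 'rV[R]_n) :
  {for x, continuous f} <->
  forall e, 0 < e -> exists2 d, 0 < d &
    forall y, enorm (y - x) < d -> `|f y - f x| < e.
Proof.
split=> [fx e e0|fx A /nbhs_ballP[e /= e0 eA]].
  have /fx/nbhs_enormP[d d0 dP] : nbhs (f x) (ball (f x) e) by exact: nbhsx_ballx.
  by exists d => // y /dP /=; rewrite /ball /= distrC.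
have [d d0 dP] := fx _ e0.
by apply/nbhs_enormP; exists d => // y /dP yx; apply: eA; rewrite /ball /= distrC.
Qed.

Lemma enorm_continuous (R : realType) n (c : 'rV[R]_n) :
  continuous (fun x : 'rV[R]_n => enorm (x - c)).
Proof.
move=> x; apply/continuous_enormP => e e0; exists e => // y yx.
have h1 := enorm_triangle x y c; have h2 := enorm_triangle y x c.
by rewrite (enorm_distC x y) in h1; rewrite ltr_norml; apply/andP; split; lra.
Qed.

Definition cball (R : realType) (n : nat) (c : 'rV[R]_n) (r : R) : set 'rV[R]_n :=
  [set x | enorm (x - c) <= r].

Lemma cball_center (R : realType) n (c : 'rV[R]_n) (r : R) :
  0 <= r -> cball c r c.
Proof. by rewrite /cball /= subrr enorm0. Qed.

Lemma cball_compact (R : realType) n (c : 'rV[R]_n) (r : R) : compact (cball c r).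
Proof.
apply: bounded_closed_compact.
  exists (enorm c + r); split; rewrite ?num_real // => t ht x /= xc.
  apply/ltW/(le_lt_trans _ ht)/(le_trans (norm_le_enorm _)).
  by rewrite -[X in enorm X](subrK c) addrC; apply: le_trans (enormD _ _) _; rewrite lerD2l.
have -> : cball c r = (fun x : 'rV[R]_n => enorm (x - c)) @^-1` [set t | t <= r] by [].
by apply: closed_comp => // x _; exact: enorm_continuous.
Qed.

(** * Polynomials as test functions *)

Lemma mpoly_ring_ind (R : realType) n (P : mpoly n R -> Prop) :
  (forall c, P (mpolyC n c)) -> (forall i, P (mpolyX R (mnm1 i))) ->
  (forall p q, P p -> P q -> P (p + q)) ->
  (forall p q, P p -> P q -> P (p * q)) -> forall p, P p.
Proof.
move=> PC PX PD PM; have P0 : P 0 by have := PC 0; rewrite mpolyC0.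
apply: mpolyind => // c m p _ _ Pp; apply: PD => //.
rewrite -mul_mpolyC; apply: (PM) => //; rewrite mpolyXE_id.
elim/big_rec: _ => [|i q _ Pq]; first exact: PC.
apply: (PM) => //; elim: (m i) => [|k IH]; rewrite ?expr0 ?exprS; first exact: PC.
exact: PM.
Qed.

Definition peval (R : realType) n (p : mpoly n R) (x : 'rV[R]_n) : R :=
  meval (fun i => x ord0 i) p.

Lemma pevalC (R : realType) n (c : R) (x : 'rV[R]_n) : peval (mpolyC n c) x = c.
Proof. exact: mevalC. Qed.
Lemma pevalX (R : realType) n i (x : 'rV[R]_n) :
  peval (mpolyX R (mnm1 i)) x = x ord0 i.
Proof. exact: mevalXU. Qed.
Lemma pevalD (R : realType) n (p q : mpoly n R) x :
  peval (p + q) x = peval p x + peval q x.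
Proof. exact: mevalD. Qed.
Lemma pevalN (R : realType) n (p : mpoly n R) x : peval (- p) x = - peval p x.
Proof. exact: mevalN. Qed.
Lemma pevalM (R : realType) n (p q : mpoly n R) x :
  peval (p * q) x = peval p x * peval q x.
Proof. exact: mevalM. Qed.
Lemma pevalZ (R : realType) n (c : R) (p : mpoly n R) x :
  peval (c *: p) x = c * peval p x.
Proof. exact: mevalZ. Qed.
Lemma peval0 (R : realType) n (x : 'rV[R]_n) : peval 0 x = 0.
Proof. exact: meval0. Qed.
Lemma peval1 (R : realType) n (x : 'rV[R]_n) : peval 1 x = 1.
Proof. exact: meval1. Qed.
Lemma peval_sum (R : realType) n (I : Type) (r : seq I) (P : pred I)
    (F : I -> mpoly n R) x :
  peval (\sum_(i <- r | P i) F i) x = \sum_(i <- r | P i) peval (F i) x.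
Proof. by apply: (big_morph (fun p => peval p x)) => [p q|]; rewrite ?pevalD ?peval0. Qed.
Lemma peval_exp (R : realType) n (p : mpoly n R) k x :
  peval (p ^+ k) x = peval p x ^+ k.
Proof. by elim: k => [|k IH]; rewrite ?expr0 ?peval1 // !exprS pevalM IH. Qed.
Lemma peval_prod (R : realType) n (I : Type) (r : seq I) (P : pred I)
    (F : I -> mpoly n R) x :
  peval (\prod_(i <- r | P i) F i) x = \prod_(i <- r | P i) peval (F i) x.
Proof. by apply: (big_morph (fun p => peval p x)) => [p q|]; rewrite ?pevalM ?peval1. Qed.

Definition pevalE := (pevalC, pevalX, pevalD, pevalN, pevalM, pevalZ, peval1,
  peval0, peval_sum, peval_exp, peval_prod).

Lemma mderiv_XU (R : realType) n (i j : 'I_n) :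
  mderiv i (mpolyX R (mnm1 j)) = mpolyC n ((i == j)%:R : R).
Proof.
rewrite mderivX mnm1E; have [->|ji] := eqVneq j i; last by rewrite scale0r mpolyC0.
rewrite scale1r; have -> : mnm_sub (mnm1 i) (mnm1 i) = mnm0.
  by apply/mnmP => k; rewrite mnmBE mnm0E subnn.
by rewrite mpolyX0.
Qed.

Lemma is_derive_peval (R : realType) n (p : mpoly n R) (x v : 'rV[R]_n) :
  is_derive x v (peval p) (\sum_(i < n) v ord0 i * peval (mderiv i p) x).
Proof.
elim/mpoly_ring_ind: p => [c|j|p q Hp Hq|p q Hp Hq].
- rewrite (_ : peval _ = cst c); last by apply/funext => y; rewrite pevalC.
  rewrite big1; first exact: is_derive_cst.
  by move=> i _; rewrite mderivC peval0 mulr0.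
- rewrite (_ : \sum_(i < n) _ = v ord0 j).
    rewrite (_ : peval _ = fun y : 'rV[R]_n => y ord0 j); last first.
      by apply/funext => y; rewrite pevalX.
    have cv : h^-1 *: (((fun y : 'rV[R]_n => y ord0 j) \o shift x) (h *: v) - x ord0 j)
        @[h --> 0^'] --> v ord0 j.
      apply: cvg_near_cst; near=> h.
      by rewrite /= !mxE addrK scalerA mulVf ?scale1r //; near: h; exact: nbhs_dnbhs_neq.
    by apply: DeriveDef; [exact: cvgP cv|exact: cvg_lim cv].
  rewrite (bigD1 j) //= mderiv_XU eqxx pevalC mulr1 big1 ?addr0 // => i /negPf ij.
  by rewrite mderiv_XU ij pevalC mulr0.
- rewrite (_ : peval _ = peval p + peval q); last by apply/funext => y; rewrite pevalD.
  rewrite (_ : \sum_(i < n) _ = \sum_(i < n) v ord0 i * peval (mderiv i p) x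
     + \sum_(i < n) v ord0 i * peval (mderiv i q) x); first exact: is_deriveD.
  by rewrite -big_split; apply: eq_bigr => i _; rewrite mderivD pevalD mulrDr.
- rewrite (_ : peval _ = peval p * peval q); last by apply/funext => y; rewrite pevalM.
  apply: (is_derive_eq (is_deriveM _ _)).
  rewrite !scaler_sumr -big_split; apply: eq_bigr => i _.
  rewrite mderivM !pevalE /GRing.scale /=; ring.
Unshelve. all: by end_near. Qed.

Lemma peval_continuous (R : realType) n (p : mpoly n R) : continuous (peval p).
Proof.
elim/mpoly_ring_ind: p => [c|j|p q Hp Hq|p q Hp Hq].
- by rewrite (_ : peval _ = cst c); [exact: cst_continuous|apply/funext => y; rewrite pevalC].
- rewrite (_ : peval _ = fun y : 'rV[R]_n => y ord0 j); first exact: coord_continuous.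
  by apply/funext => y; rewrite pevalX.
- rewrite (_ : peval _ = peval p + peval q); last by apply/funext => y; rewrite pevalD.
  by move=> x; apply: continuousD; [exact: Hp|exact: Hq].
- rewrite (_ : peval _ = peval p * peval q); last by apply/funext => y; rewrite pevalM.
  by move=> x; apply: continuousM; [exact: Hp|exact: Hq].
Qed.

Lemma partial_peval (R : realType) n (i : 'I_n) (p : mpoly n R) :
  partial i (peval p) = peval (mderiv i p).
Proof.
apply/funext => x; rewrite /partial; have [_ ->] := is_derive_peval p x (delta_mx ord0 i).
rewrite (bigD1 i) //= mxE !eqxx mul1r big1 ?addr0 // => j /negPf ji.
by rewrite mxE ji andbF mul0r.
Qed.

Lemma C2_near_peval (R : realType) n (p : mpoly n R) x : C2_near x (peval p).
Proof.
have C1 q : C1_on setT (peval q : 'rV[R]_n -> R).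
  move=> i; split=> [y _|]; first by have [] := is_derive_peval q y (delta_mx ord0 i).
  by rewrite partial_peval; apply: continuous_subspaceT; exact: peval_continuous.
exists setT; split=> //; first exact: openT.
by split=> [|i]; rewrite ?partial_peval; exact: C1.
Qed.

Definition lap (R : realType) n (p : mpoly n R) : mpoly n R :=
  \sum_(i < n) mderiv i (mderiv i p).

Definition grad_sqr (R : realType) n (p : mpoly n R) : mpoly n R :=
  \sum_(i < n) mderiv i p * mderiv i p.

Definition grad_dot (R : realType) n (p q : mpoly n R) : mpoly n R :=
  \sum_(i < n) mderiv i p * mderiv i q.

Lemma laplacian_peval (R : realType) n (p : mpoly n R) x :
  laplacian (peval p) x = peval (lap p) x.
Proof. by rewrite peval_sum; apply: eq_bigr => i _; rewrite !partial_peval. Qed.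

Lemma enorm_gradient_peval (R : realType) n (p : mpoly n R) x :
  enorm (gradient (peval p) x) = Num.sqrt (peval (grad_sqr p) x).
Proof.
rewrite enormE; congr Num.sqrt; rewrite peval_sum.
by apply: eq_bigr => i _; rewrite !mxE partial_peval pevalM.
Qed.

Lemma grad_sqr_ge0 (R : realType) n (p : mpoly n R) x : 0 <= peval (grad_sqr p) x.
Proof. by rewrite peval_sum sumr_ge0 // => i _; rewrite pevalM -expr2 sqr_ge0. Qed.

Lemma lapD (R : realType) n (p q : mpoly n R) : lap (p + q) = lap p + lap q.
Proof. by rewrite -big_split; apply: eq_bigr => i _; rewrite !mderivD. Qed.

Lemma lapC (R : realType) n (c : R) : lap (mpolyC n c) = 0.
Proof. by apply: big1 => i _; rewrite !mderivC. Qed.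

Lemma lap0 (R : realType) n : lap (0 : mpoly n R) = 0.
Proof. by rewrite -mpolyC0 lapC. Qed.

Lemma lapZ (R : realType) n (c : R) (p : mpoly n R) : lap (c *: p) = c *: lap p.
Proof. by rewrite scaler_sumr; apply: eq_bigr => i _; rewrite !mderivZ. Qed.

Lemma lapN (R : realType) n (p : mpoly n R) : lap (- p) = - lap p.
Proof. by rewrite -scaleN1r lapZ scaleN1r. Qed.

Lemma lapB (R : realType) n (p q : mpoly n R) : lap (p - q) = lap p - lap q.
Proof. by rewrite lapD lapN. Qed.

Lemma lapM (R : realType) n (p q : mpoly n R) :
  lap (p * q) = lap p * q + 2%:R * grad_dot p q + p * lap q.
Proof.
rewrite mulr_suml !mulr_sumr -!big_split; apply: eq_bigr => i _.
by rewrite !(mderivM, mderivD) /=; ring.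
Qed.

Lemma grad_sqrZ (R : realType) n (c : R) (p : mpoly n R) :
  grad_sqr (c *: p) = c ^+ 2 *: grad_sqr p.
Proof.
rewrite scaler_sumr; apply: eq_bigr => i _.
by rewrite !mderivZ -scalerAl -scalerAr scalerA expr2.
Qed.

Definition sqdist (R : realType) n (c : 'rV[R]_n) : mpoly n R :=
  \sum_(i < n) (mpolyX R (mnm1 i) - mpolyC n (c ord0 i)) ^+ 2.

Lemma peval_sqdist (R : realType) n (c x : 'rV[R]_n) :
  peval (sqdist c) x = enorm (x - c) ^+ 2.
Proof.
rewrite enorm_sqr peval_sum; apply: eq_bigr => i _.
by rewrite !pevalE !mxE expr2.
Qed.

Lemma mderiv_sqdist (R : realType) n (c : 'rV[R]_n) i :
  mderiv i (sqdist c) = 2%:R *: (mpolyX R (mnm1 i) - mpolyC n (c ord0 i)).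
Proof.
rewrite raddf_sum (bigD1 i) //= big1 ?addr0 => [|j /negPf ji].
  by rewrite expr2 mderivM mderivB mderivC subr0 mderiv_XU eqxx mpolyC1 mul1r mulr1 -mulr2n
      scaler_nat.
by rewrite expr2 mderivM mderivB mderivC subr0 mderiv_XU eq_sym ji mpolyC0 mul0r mulr0 addr0.
Qed.

Lemma lap_sqdist (R : realType) n (c : 'rV[R]_n) :
  lap (sqdist c) = mpolyC n (2 * n%:R).
Proof.
rewrite /lap (eq_bigr (fun=> mpolyC n 2)); last first.
  by move=> i _; rewrite mderiv_sqdist mderivZ mderivB mderivC subr0 mderiv_XU eqxx
      -mul_mpolyC -mpolyCM mulr1.
by rewrite sumr_const card_ord -mpolyCMn mulr_natr.
Qed.

Lemma grad_sqr_sqdist (R : realType) n (c : 'rV[R]_n) :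
  grad_sqr (sqdist c) = 4%:R *: sqdist c.
Proof.
rewrite scaler_sumr; apply: eq_bigr => i _; rewrite mderiv_sqdist.
by rewrite -scalerAl -scalerAr scalerA expr2 -natrM.
Qed.

Definition linpoly (R : realType) n (e : 'rV[R]_n) : mpoly n R :=
  \sum_(i < n) e ord0 i *: mpolyX R (mnm1 i).

Lemma peval_linpoly (R : realType) n (e x : 'rV[R]_n) : peval (linpoly e) x = dot e x.
Proof. by rewrite peval_sum; apply: eq_bigr => i _; rewrite !pevalE. Qed.

Lemma mderiv_linpoly (R : realType) n (e : 'rV[R]_n) i :
  mderiv i (linpoly e) = mpolyC n (e ord0 i).
Proof.
rewrite raddf_sum (bigD1 i) //= big1 ?addr0 => [|j /negPf ji].
  by rewrite mderivZ mderiv_XU eqxx -mul_mpolyC -mpolyCM mulr1.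
by rewrite mderivZ mderiv_XU eq_sym ji mpolyC0 scaler0.
Qed.

Lemma lap_linpoly (R : realType) n (e : 'rV[R]_n) : lap (linpoly e) = 0.
Proof. by apply: big1 => i _; rewrite mderiv_linpoly mderivC. Qed.

Lemma lap_linpoly_sqr (R : realType) n (e : 'rV[R]_n) :
  lap (linpoly e ^+ 2) = mpolyC n (2 * dot e e).
Proof.
rewrite expr2 lapM lap_linpoly mul0r mulr0 addr0 add0r /grad_dot.
rewrite (eq_bigr (fun i => mpolyC n (e ord0 i * e ord0 i))); last first.
  by move=> i _; rewrite mderiv_linpoly mpolyCM.
by rewrite -(raddf_sum (@mpolyC n R)) mpolyCM -[2%:R in RHS]natr1 // mpolyCD mpolyC1 // -[1%:R]/1.
Qed.

Definition dirderiv (R : realType) n (v : 'rV[R]_n) (p : mpoly n R) : mpoly n R :=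
  \sum_(i < n) v ord0 i *: mderiv i p.

Lemma dirderiv_delta (R : realType) n (i : 'I_n) (p : mpoly n R) :
  dirderiv (delta_mx ord0 i) p = mderiv i p.
Proof.
rewrite /dirderiv (bigD1 i) //= mxE !eqxx scale1r big1 ?addr0 // => j /negPf ji.
by rewrite mxE ji andbF scale0r.
Qed.

Lemma peval_dirderiv (R : realType) n (v : 'rV[R]_n) (p : mpoly n R) x :
  peval (dirderiv v p) x = \sum_(i < n) v ord0 i * peval (mderiv i p) x.
Proof. by rewrite peval_sum; apply: eq_bigr => i _; rewrite pevalZ. Qed.

Lemma peval_on_line (R : realType) n (p : mpoly n R) (x v : 'rV[R]_n) :
  exists q : {poly R}, forall t,
    q.[t] = peval p (x + t *: v) /\ (deriv q).[t] = peval (dirderiv v p) (x + t *: v).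
Proof.
elim/mpoly_ring_ind: p => [c|j|p q [a ha] [b hb]|p q [a ha] [b hb]].
- exists c%:P => t; rewrite !hornerE pevalC; split=> //.
  by rewrite derivC hornerC peval_dirderiv big1 // => i _; rewrite mderivC peval0 mulr0.
- exists ((x ord0 j)%:P + (v ord0 j)%:P * 'X) => t.
  rewrite derivD derivC derivM derivC derivX mul0r mulr1 !add0r hornerC.
  rewrite pevalX !hornerE !mxE mulrC; split=> //.
  rewrite peval_dirderiv (bigD1 j) //= mderiv_XU eqxx pevalC mulr1 big1 ?addr0 // => i /negPf ij.
  by rewrite mderiv_XU ij pevalC mulr0.
- exists (a + b) => t; have [a1 a2] := ha t; have [b1 b2] := hb t.
  rewrite derivD !hornerD a1 a2 b1 b2 pevalD !peval_dirderiv; split=> //.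
  by rewrite -big_split; apply: eq_bigr => i _; rewrite mderivD pevalD mulrDr.
- exists (a * b) => t; have [a1 a2] := ha t; have [b1 b2] := hb t.
  rewrite derivM !(hornerD, hornerM) a1 a2 b1 b2 pevalM !peval_dirderiv; split=> //.
  rewrite mulr_suml mulr_sumr -big_split; apply: eq_bigr => i _.
  by rewrite mderivM !pevalE /=; ring.
Qed.

Lemma horner_le_coef_sum (R : realType) (q : {poly R}) (t : R) :
  `|t| <= 1 -> `|q.[t]| <= \sum_(i < size q) `|q`_i|.
Proof.
move=> t1; rewrite horner_coef; apply: le_trans (ler_norm_sum _ _ _) _.
by apply: ler_sum => i _; rewrite normrM normrX ler_piMr // exprn_ile1.
Qed.

(** Second-order Taylor expansion along a line, with a remainder read off from
    the restriction of the polynomial to that line. *)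
Lemma taylor2 (R : realType) n (p : mpoly n R) (x v : 'rV[R]_n) :
  exists2 K : R, 0 <= K & forall t, `|t| <= 1 ->
    `|peval p (x + t *: v) - peval p x - t * peval (dirderiv v p) x
      - t ^+ 2 / 2 * peval (dirderiv v (dirderiv v p)) x| <= K * `|t| ^+ 3.
Proof.
have [q hq] := peval_on_line p x v; have [q' hq'] := peval_on_line (dirderiv v p) x v.
have eq' : deriv q = q'.
  apply/eqP; rewrite -subr_eq0; apply/eqP/(@roots_geq_poly_eq0 _ _
    [seq i%:R | i <- iota 0 (size (deriv q - q'))]).
  - by apply/allP => t _; rewrite rootE !hornerE (hq t).2 (hq' t).1 subrr.
  - by rewrite map_inj_uniq ?iota_uniq // => i j /eqP; rewrite eqr_nat => /eqP.
  - by rewrite size_map size_iota.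
have E0 : x = x + 0 *: v by rewrite scale0r addr0.
have q0 : q`_0 = peval p x by rewrite E0 -(hq 0).1 horner_coef0.
have q1 : q`_1 = peval (dirderiv v p) x by rewrite E0 -(hq 0).2 horner_coef0 coef_deriv.
have q2 : q`_2 *+ 2 = peval (dirderiv v (dirderiv v p)) x.
  by rewrite E0 -(hq' 0).2 -eq' horner_coef0 !coef_deriv mulr1n.
exists (\sum_(i < size (drop_poly 3 q)) `|(drop_poly 3 q)`_i|); first exact: sumr_ge0.
move=> t t1; rewrite -(hq t).1 -q0 -q1 -q2 -[in q.[t]](poly_take_drop 3 q).
have -> : (take_poly 3 q + drop_poly 3 q * 'X^3).[t]
    = q`_0 + q`_1 * t + q`_2 * t ^+ 2 + (drop_poly 3 q).[t] * t ^+ 3.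
  rewrite hornerD hornerM hornerXn (@horner_coef_wide _ 3 _ _ (size_take_poly _ _)).
  by rewrite !big_ord_recl big_ord0 !coef_take_poly /= /bump /=; ring.
rewrite (_ : _ - _ = (drop_poly 3 q).[t] * t ^+ 3); last by field.
by rewrite normrM normrX ler_wpM2r ?exprn_ge0 // horner_le_coef_sum.
Qed.

Lemma linear_coef_le0 (R : realType) (a C e : R) :
  0 < e -> (forall t, 0 < t < e -> t * a <= C * t ^+ 2) -> a <= 0.
Proof.
move=> e0 h; rewrite leNgt; apply/negP => a0.
have C0 : 0 < `|C| + 1 by rewrite ltr_wpDl.
pose t := Num.min (e / 2) (a / (2 * (`|C| + 1))).
have t0 : 0 < t by rewrite lt_min !divr_gt0 ?mulr_gt0.
have te : t < e by rewrite gt_min; apply/orP; left; lra.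
have ta : t * (2 * (`|C| + 1)) <= a.
  by rewrite -ler_pdivlMr ?mulr_gt0 // ge_min lexx orbT.
have := h t; rewrite t0 te => /(_ isT); rewrite expr2 mulrCA ler_pM2l // leNgt => /negP; apply.
have := ler_norm C; nra.
Qed.

(** The first and second derivative tests: in the Taylor expansion along [v]
    the remainder is of third order, so a maximum forces the linear coefficient
    to vanish and the quadratic one to be nonpositive. *)
Lemma local_max_dirderiv (R : realType) n (p : mpoly n R) (x v : 'rV[R]_n) :
  local_max (peval p) x ->
  peval (dirderiv v p) x = 0 /\ peval (dirderiv v (dirderiv v p)) x <= 0.
Proof.
move=> /nbhs_enormP[e e0 he]; have [K K0 hK] := taylor2 p x v.
set a := peval (dirderiv v p) x in hK *; set b := peval (dirderiv v (dirderiv v p)) x in hK *.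
pose d := Num.min 1 (e / (enorm v + 1)).
have v1 : 0 < enorm v + 1 by rewrite ltr_wpDl ?enorm_ge0.
have d0 : 0 < d by rewrite lt_min ltr01 divr_gt0.
have main t : `|t| < d -> t * a + t ^+ 2 / 2 * b <= K * `|t| ^+ 3.
  rewrite lt_min => /andP[t1]; rewrite ltr_pdivlMr // => te.
  have := hK t (ltW t1); rewrite ler_norml => /andP[+ _].
  have /he : enorm (x + t *: v - x) < e.
    rewrite addrC addKr enormZ; apply: le_lt_trans te.
    by rewrite ler_wpM2l // lerDl.
  lra.
have d1 : d <= 1 by rewrite ge_min lexx.
have bound t : 0 < t < d -> `|t| = t /\ t ^+ 3 <= t ^+ 2.
  move=> /andP[t0 td]; rewrite (ger0_norm (ltW t0)); split=> //.
  by rewrite exprS ler_piMl ?sqr_ge0 //; apply/ltW/(lt_le_trans td).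
have bt2 t : - (t ^+ 2 / 2 * b) <= `|b| * t ^+ 2.
  have h1 : 0 <= t ^+ 2 * (`|b| + b).
    by rewrite mulr_ge0 ?sqr_ge0 //; have := ler_norm (- b); rewrite normrN; lra.
  have h2 : 0 <= t ^+ 2 * `|b| by rewrite mulr_ge0 ?sqr_ge0.
  lra.
have a0 : a = 0.
  apply/eqP; rewrite eq_le -[0 <= a]oppr_le0; apply/andP; split.
    apply: (linear_coef_le0 (C := K + `|b|) d0) => t td; have [tt t3] := bound t td.
    have := main t; rewrite tt => /(_ (proj2 (andP td))).
    by have := ler_wpM2l K0 t3; have := bt2 t; lra.
  apply: (linear_coef_le0 (C := K + `|b|) d0) => t td; have [tt t3] := bound t td.
  have := main (- t); rewrite normrN tt sqrrN => /(_ (proj2 (andP td))).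
  by have := ler_wpM2l K0 t3; have := bt2 t; lra.
split=> //; apply: (linear_coef_le0 (C := 2 * K) d0) => t td.
have [tt _] := bound t td; have /andP[t0 td'] := td.
have := main t; rewrite tt a0 mulr0 add0r => /(_ td').
rewrite (_ : t ^+ 2 / 2 * b = t * (t * b / 2)); last by field.
by rewrite (_ : K * t ^+ 3 = t * (K * t ^+ 2)); [rewrite ler_pM2l //; lra|ring].
Qed.

Lemma local_max_lap (R : realType) n (p : mpoly n R) (x : 'rV[R]_n) :
  local_max (peval p) x -> peval (lap p) x <= 0.
Proof.
move=> hp; rewrite peval_sum sumr_le0 // => i _.
by have [_] := local_max_dirderiv (delta_mx ord0 i) hp; rewrite !dirderiv_delta.
Qed.

Definition affcomp (R : realType) n (A : 'M[R]_n) (b : 'rV[R]_n) (p : mpoly n R) :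
    mpoly n R :=
  comp_mpoly [tuple linpoly (\row_j A j i) + mpolyC n (b ord0 i) | i < n] p.

Lemma peval_affcomp (R : realType) n (A : 'M[R]_n) (b : 'rV[R]_n) (p : mpoly n R) x :
  peval (affcomp A b p) x = peval p (x *m A + b).
Proof.
rewrite /peval /affcomp comp_mpoly_meval; apply: meval_eq => i.
rewrite tnth_mktuple -/(peval _ x) pevalD pevalC peval_linpoly !mxE; congr (_ + _).
by apply: eq_bigr => j _; rewrite mxE mulrC.
Qed.

Lemma mderiv_affcomp (R : realType) n (A : 'M[R]_n) (b : 'rV[R]_n) (p : mpoly n R) j :
  mderiv j (affcomp A b p) = \sum_(i < n) A j i *: affcomp A b (mderiv i p).
Proof.
elim/mpoly_ring_ind: p => [c|k|p q Hp Hq|p q Hp Hq].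
- rewrite /affcomp comp_mpolyC mderivC big1 // => i _.
  by rewrite mderivC comp_mpoly0 scaler0.
- rewrite {1}/affcomp comp_mpolyXU -tnth_nth tnth_mktuple mderivD mderivC addr0 mderiv_linpoly mxE.
  rewrite (bigD1 k) //= mderiv_XU eqxx /affcomp comp_mpolyC big1 ?addr0 => [|i /negPf ik].
    by rewrite mpolyC1 -mul_mpolyC mulr1.
  by rewrite mderiv_XU ik comp_mpolyC mpolyC0 scaler0.
- rewrite {1}/affcomp comp_mpolyD mderivD Hp Hq -big_split; apply: eq_bigr => i _.
  by rewrite mderivD /affcomp comp_mpolyD scalerDr.
- rewrite {1}/affcomp rmorphM mderivM Hp Hq mulr_suml mulr_sumr -big_split.
  apply: eq_bigr => i _; rewrite mderivM /affcomp comp_mpolyD !rmorphM.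
  by rewrite scalerDr -scalerAl -scalerAr.
Qed.

Lemma affcomp_sum (R : realType) n (A : 'M[R]_n) (b : 'rV[R]_n) (F : 'I_n -> mpoly n R) :
  affcomp A b (\sum_i F i) = \sum_i affcomp A b (F i).
Proof. exact: raddf_sum. Qed.

Lemma affcompM (R : realType) n (A : 'M[R]_n) (b : 'rV[R]_n) (p q : mpoly n R) :
  affcomp A b (p * q) = affcomp A b p * affcomp A b q.
Proof. exact: rmorphM. Qed.

Lemma lap_affcomp (R : realType) n (A : 'M[R]_n) (b : 'rV[R]_n) (c : R)
    (p : mpoly n R) :
  A^T *m A = c%:M -> lap (affcomp A b p) = c *: affcomp A b (lap p).
Proof.
move=> AA; rewrite /lap.
under eq_bigr => j _.
  rewrite mderiv_affcomp raddf_sum /=.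
  under eq_bigr => i _ do rewrite mderivZ mderiv_affcomp scaler_sumr.
  over.
rewrite exchange_big /= affcomp_sum scaler_sumr; apply: eq_bigr => i _.
rewrite exchange_big /= (bigD1 i) //= [X in _ + X]big1 ?addr0 => [|k ki].
  under eq_bigr => j _ do rewrite scalerA.
  rewrite -scaler_suml; congr (_ *: _); have := congr1 (fun M : 'M[R]_n => M i i) AA.
  by rewrite !mxE eqxx mulr1n => <-; apply: eq_bigr => j _; rewrite mxE.
under eq_bigr => j _ do rewrite scalerA.
rewrite -scaler_suml; have := congr1 (fun M : 'M[R]_n => M i k) AA.
rewrite !mxE eq_sym (negPf ki) mulr0n => h.
have -> : \sum_j A j i * A j k = 0 by rewrite -[RHS]h; apply: eq_bigr => j _; rewrite mxE.
exact: scale0r.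
Qed.

Lemma grad_sqr_affcomp (R : realType) n (A : 'M[R]_n) (b : 'rV[R]_n) (c : R)
    (p : mpoly n R) :
  A^T *m A = c%:M -> grad_sqr (affcomp A b p) = c *: affcomp A b (grad_sqr p).
Proof.
move=> AA; rewrite /grad_sqr.
under eq_bigr => j _.
  rewrite mderiv_affcomp mulr_suml.
  under eq_bigr => i _ do rewrite mulr_sumr.
  over.
rewrite exchange_big /= affcomp_sum scaler_sumr; apply: eq_bigr => i _.
rewrite exchange_big /= (bigD1 i) //= [X in _ + X]big1 ?addr0 => [|k ki].
  under eq_bigr => j _ do rewrite -scalerAl -scalerAr scalerA.
  rewrite -scaler_suml affcompM; congr (_ *: _); have := congr1 (fun M : 'M[R]_n => M i i) AA.
  by rewrite !mxE eqxx mulr1n => <-; apply: eq_bigr => j _; rewrite mxE.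
under eq_bigr => j _ do rewrite -scalerAl -scalerAr scalerA.
rewrite -scaler_suml; have := congr1 (fun M : 'M[R]_n => M i k) AA.
rewrite !mxE eq_sym (negPf ki) mulr0n => h.
have -> : \sum_j A j i * A j k = 0 by rewrite -[RHS]h; apply: eq_bigr => j _; rewrite mxE.
exact: scale0r.
Qed.

(** * Harmonic polynomials with prescribed values on a sphere *)

Definition cube (R : realType) (n : nat) (c : 'rV[R]_n) (r : R) : set 'rV[R]_n :=
  [set x | forall i, `|x ord0 i - c ord0 i| <= r].

Lemma cball_sub_cube (R : realType) n (c : 'rV[R]_n) (r : R) :
  cball c r `<=` cube c r.
Proof.
move=> x xc i; apply: le_trans xc.
by rewrite (_ : x ord0 i - c ord0 i = (x - c) ord0 i) ?coord_le_enorm // !mxE.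
Qed.

Definition cube_coord (R : realType) n (c : 'rV[R]_n) (r : R) (i : 'I_n) : mpoly n R :=
  (2 * r)^-1 *: (mpolyX R (mnm1 i) - mpolyC n (c ord0 i - r)).

(** The Bernstein polynomial of [g] as the expectation of [g] at the end of a
    random walk started at [xi]: each entry [i] of [s] is a move by [h] in
    direction [i], made with probability [cube_coord c r i]. *)
Fixpoint bernstein (R : realType) n (c : 'rV[R]_n) (r h : R) (s : seq 'I_n)
    (g : 'rV[R]_n -> R) (xi : 'rV[R]_n) : mpoly n R :=
  if s is i :: s' then
    cube_coord c r i * bernstein c r h s' g (xi + h *: delta_mx ord0 i)
    + (1 - cube_coord c r i) * bernstein c r h s' g xi
  else mpolyC n (g xi).

Lemma bernsteinD (R : realType) n (c : 'rV[R]_n) r h s (g g' : 'rV[R]_n -> R)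
    (xi x : 'rV[R]_n) :
  peval (bernstein c r h s (fun z => g z + g' z) xi) x =
  peval (bernstein c r h s g xi) x + peval (bernstein c r h s g' xi) x.
Proof.
elim: s xi => [|i s IH] xi /=; first by rewrite !pevalC.
by rewrite !(pevalD, pevalM) !IH; ring.
Qed.

Lemma bernsteinZ (R : realType) n (c : 'rV[R]_n) r h s a (g : 'rV[R]_n -> R)
    (xi x : 'rV[R]_n) :
  peval (bernstein c r h s (fun z => a * g z) xi) x =
  a * peval (bernstein c r h s g xi) x.
Proof.
elim: s xi => [|i s IH] xi /=; first by rewrite !pevalC.
by rewrite !(pevalD, pevalM) !IH; ring.
Qed.

Lemma bernsteinC (R : realType) n (c : 'rV[R]_n) r h s (a : R) (xi x : 'rV[R]_n) :
  peval (bernstein c r h s (fun=> a) xi) x = a.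
Proof.
elim: s xi => [|i s IH] xi /=; first by rewrite !pevalC.
by rewrite !pevalD !pevalM !IH !pevalE; ring.
Qed.

Lemma bernstein_sum (R : realType) n (c : 'rV[R]_n) r h s (I : Type) (t : seq I)
    (g : I -> 'rV[R]_n -> R) (xi x : 'rV[R]_n) :
  peval (bernstein c r h s (fun z => \sum_(i <- t) g i z) xi) x =
  \sum_(i <- t) peval (bernstein c r h s (g i) xi) x.
Proof.
elim: t => [|i t IH].
  rewrite big_nil -[RHS](bernsteinC c r h s 0 xi x).
  by congr (peval (bernstein _ _ _ _ _ _) _); apply/funext => z; rewrite big_nil.
rewrite big_cons -IH -bernsteinD; congr (peval (bernstein _ _ _ _ _ _) _).
by apply/funext => z; rewrite big_cons.
Qed.

Lemma cube_coord_bounds (R : realType) n (c x : 'rV[R]_n) r i :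
  0 < r -> cube c r x -> 0 <= peval (cube_coord c r i) x <= 1.
Proof.
move=> r0 /(_ i); rewrite ler_norml => /andP[x1 x2].
by rewrite !pevalE mulrC divr_ge0 /= ?ler_pdivrMr; lra.
Qed.

Lemma ler_bernstein (R : realType) n (c : 'rV[R]_n) r h s (g g' : 'rV[R]_n -> R)
    (xi x : 'rV[R]_n) :
  0 < r -> 0 <= h -> cube c r x ->
  (forall z : 'rV[R]_n, (forall i, xi ord0 i <= z ord0 i <= xi ord0 i + h * (count_mem i s)%:R) ->
    g z <= g' z) ->
  peval (bernstein c r h s g xi) x <= peval (bernstein c r h s g' xi) x.
Proof.
move=> r0 h0 xc; elim: s xi => [|i s IH] xi le_g /=.
  by rewrite !pevalC le_g // => i; rewrite /= mulr0 addr0 lexx.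
have /andP[y0 y1] := cube_coord_bounds i r0 xc.
rewrite !(pevalD, pevalM) lerD //; apply: ler_wpM2l => //.
- apply: IH => z hz; apply: le_g => j; have /andP[z1 z2] := hz j.
  rewrite !mxE /= eq_sym in z1 z2 *; case: eqP z1 z2 => _ /=; rewrite natrD.
    by rewrite mulr1 mulr1n => z1 z2; apply/andP; split; lra.
  by rewrite mulr0 addr0 add0r => -> ->.
- by rewrite pevalN peval1 subr_ge0.
- apply: IH => z hz; apply: le_g => j; have /andP[-> z2] := hz j.
  by rewrite /= natrD mulrDr; apply: (le_trans z2); rewrite lerD2l lerDr mulr_ge0.
Qed.

(** Mean and variance of the walk at once.  Leaving the point [a] free is what
    makes the induction on the walk go through, the start [xi] moving. *)
Lemma bernstein_second_moment (R : realType) n (c : 'rV[R]_n) r h s i a (xi x : 'rV[R]_n) :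
  let y := peval (cube_coord c r i) x in
  let N := (count_mem i s)%:R in
  peval (bernstein c r h s (fun z => (z ord0 i - a) ^+ 2) xi) x =
  (xi ord0 i + h * N * y - a) ^+ 2 + h ^+ 2 * N * y * (1 - y).
Proof.
move=> y /=; elim: s xi => [|j s IH] xi /=; first by rewrite pevalC; ring.
rewrite !(pevalD, pevalM) !IH !mxE pevalN peval1 eqxx /= eq_sym natrD.
by have [->|ji] := eqVneq j i; rewrite ?mulr1n ?mulr0n /=; rewrite -?/y; ring.
Qed.

(** Run [m] steps of length [2 * r / m] in each direction from the lowest corner
    of the cube: the end of the walk has mean [x] and variance of order [1 / m].
    The Lipschitz bound is linear in the displacement, and is made quadratic by
    [t <= eta + t ^ 2 / eta]. *)
Lemma weierstrass_lipschitz (R : realType) n (c : 'rV[R]_n) (r : R)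
    (f : 'rV[R]_n -> R) (L d : R) :
  0 < r -> 0 <= L -> 0 < d ->
  (forall x y, cube c r x -> cube c r y -> `|f x - f y| <= L * enorm (x - y)) ->
  exists p : mpoly n R, forall x, cube c r x -> `|peval p x - f x| <= d.
Proof.
move=> r0 L0 d0 lipf.
pose eta := d / (2 * (L + 1)); have eta0 : 0 < eta by rewrite divr_gt0 //; lra.
have Leta : L * eta <= d / 2.
  by rewrite /eta mulrA ler_pdivrMr; [nra|lra].
have ed0 : 0 < eta * d by rewrite mulr_gt0.
clearbody eta.
have q0 : 0 <= 2 * L * n%:R * r ^+ 2 / (eta * d).
  by apply: divr_ge0; [|exact: ltW];
    apply: mulr_ge0; [rewrite !mulr_ge0|exact: sqr_ge0].
pose m := (Num.bound (2 * L * n%:R * r ^+ 2 / (eta * d))).+1.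
have m0 : (0 : R) < m%:R by rewrite ltr0n.
have hm : L / eta * (n%:R * (r ^+ 2 / m%:R)) <= d / 2.
  have : 2 * L * n%:R * r ^+ 2 / (eta * d) < m%:R.
    by apply: lt_trans (archi_boundP q0) _; rewrite ltr_nat.
  rewrite (ltr_pdivrMr _ _ ed0) => h.
  rewrite (_ : L / eta * _ = (L * n%:R * r ^+ 2) / (eta * m%:R)); last by field; rewrite !gt_eqF.
  by rewrite ler_pdivrMr ?mulr_gt0 //; lra.
pose h := 2 * r / m%:R; pose xi := c - const_mx r.
pose s := flatten [seq nseq m i | i <- enum 'I_n].
have cs i : count_mem i s = m.
  rewrite /s count_flatten -map_comp sumnE big_map big_enum /= (bigD1 i) //= count_nseq /=
      eqxx mul1n.
  by rewrite big1 ?addn0 // => j /negPf ji; rewrite count_nseq /= ji mul0n.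
exists (bernstein c r h s f xi) => x xc.
pose K (z : 'rV[R]_n) := L * eta + L / eta * \sum_(i < n) (z ord0 i - x ord0 i) ^+ 2.
have EK : peval (bernstein c r h s K xi) x <= d.
  rewrite /K bernsteinD bernsteinC bernsteinZ bernstein_sum.
  have le i : peval (bernstein c r h s (fun z => (z ord0 i - x ord0 i) ^+ 2) xi) x <= r ^+ 2 / m%:R.
    rewrite bernstein_second_moment cs !mxE; set y := peval _ x.
    have -> : c ord0 i - r + h * m%:R * y - x ord0 i = 0.
      by rewrite /h /y !pevalE; field; rewrite !gt_eqF.
    rewrite expr0n add0r /h (_ : _ * y * _ = r ^+ 2 / m%:R * (4 * (y * (1 - y))));
        last by field; rewrite gt_eqF.
    rewrite ler_piMr ?divr_ge0 ?sqr_ge0 ?(ltW m0) //.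
    by have := sqr_ge0 (2 * y - 1); lra.
  have : \sum_(i < n) peval (bernstein c r h s (fun z => (z ord0 i - x ord0 i) ^+ 2) xi) x
      <= \sum_(i < n) r ^+ 2 / m%:R by apply: ler_sum => i _; exact: le.
  rewrite sumr_const card_ord -mulr_natl => le'.
  have : 0 <= L / eta by rewrite divr_ge0 // ltW.
  by move=> /ler_wpM2l /(_ _ _ le'); lra.
have box (z : 'rV[R]_n) : (forall i, xi ord0 i <= z ord0 i <= xi ord0 i + h * (count_mem i s)%:R) ->
    `|f x - f z| <= K z.
  move=> hz; have zc : cube c r z.
    move=> i; have := hz i; rewrite cs !mxE /h divfK ?gt_eqF // => /andP[z1 z2].
    by rewrite ler_norml; apply/andP; split; lra.
  apply: le_trans (lipf _ _ xc zc) _; rewrite enorm_distC /K.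
  have -> : \sum_(i < n) (z ord0 i - x ord0 i) ^+ 2 = enorm (z - x) ^+ 2.
    by rewrite enorm_sqr; apply: eq_bigr => i _; rewrite !mxE expr2.
  rewrite -mulrA -mulrDr ler_wpM2l //; set t := enorm _.
  rewrite -(ler_pM2l eta0) mulrDr mulrA divff ?gt_eqF // mul1r.
  by have := sqr_ge0 (t - eta); have := sqr_ge0 t; have := sqr_ge0 eta; nra.
have h0 : 0 <= h by rewrite divr_ge0 ?mulr_ge0 // ltW.
clearbody K.
have lo : peval (bernstein c r h s (fun=> f x) xi) x <=
    peval (bernstein c r h s (fun z => f z + K z) xi) x.
  apply: ler_bernstein => // z hz.
  by have := box z hz; rewrite ler_norml => /andP[_] /=; lra.
have hi : peval (bernstein c r h s f xi) x <=
    peval (bernstein c r h s (fun z => f x + K z) xi) x.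
  apply: ler_bernstein => // z hz.
  by have := box z hz; rewrite ler_norml => /andP[+ _] /=; lra.
move: lo hi; rewrite !bernsteinD !bernsteinC => lo hi.
by rewrite ler_norml; apply/andP; split; lra.
Qed.

(** The form in which comparison with the boundary values is used throughout:
    the hypothesis on local maxima is what a viscosity inequality refutes. *)
Lemma le_sphere (R : realType) n (g : 'rV[R]_n -> R) (c : 'rV[R]_n) (r A : R) :
  continuous g ->
  (forall x, enorm (x - c) < r -> ~ local_max g x) ->
  (forall x, enorm (x - c) = r -> g x <= A) ->
  forall x, cball c r x -> g x <= A.
Proof.
move=> cg nomax gA x xc.
have ne : cball c r !=set0 by exists x.
have cgw : {within cball c r, continuous g} by exact: continuous_subspaceT.
have [y /set_mem yc ymax] := compact_EVT_max ne (@cball_compact _ _ c r) cgw.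
apply: le_trans (ymax x (mem_set xc)) _; apply: gA; apply/eqP; rewrite eq_le.
rewrite [X in X && _](yc : enorm (y - c) <= r) leNgt; apply/negP => yr.
apply: (nomax y yr); apply/nbhs_enormP; exists (r - enorm (y - c)); first by rewrite subr_gt0.
move=> z zy; apply/ymax/mem_set; rewrite /cball /=.
by have := enorm_triangle z y c; lra.
Qed.

(** A small multiple of the squared distance to the centre makes a harmonic
    polynomial strictly subharmonic, which rules out interior maxima. *)
Lemma harmonic_eq0 (R : realType) n (q : mpoly n R) (c : 'rV[R]_n) (r : R) :
  (0 < n)%N -> lap q = 0 -> (forall x, enorm (x - c) = r -> peval q x = 0) ->
  forall x, cball c r x -> peval q x = 0.
Proof.
move=> n0 lq q0; have le0 (q' : mpoly n R) : lap q' = 0 ->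
    (forall x, enorm (x - c) = r -> peval q' x = 0) ->
    forall x, cball c r x -> peval q' x <= 0.
  move=> lq' q'0 x xc; apply/ler_addgt0Pl => e e0.
  have r2 : 0 < r ^+ 2 + 1 by rewrite ltr_wpDl ?sqr_ge0.
  pose h := e / (r ^+ 2 + 1); have h0 : 0 < h by rewrite divr_gt0.
  have hr : h * r ^+ 2 <= e by rewrite /h mulrAC ler_pdivrMr // ler_pM2l // lerDl.
  have -> : peval q' x = peval (q' + h *: sqdist c) x - h * enorm (x - c) ^+ 2.
    by rewrite pevalD pevalZ peval_sqdist addrK.
  have : peval (q' + h *: sqdist c) x <= h * r ^+ 2.
    apply: (le_sphere (@peval_continuous _ _ _) _ _ xc) => y yr.
      move=> /local_max_lap; rewrite lapD lq' add0r lapZ lap_sqdist pevalZ pevalC.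
      by apply/negP; rewrite -ltNge; do 2 apply: mulr_gt0 => //; rewrite ltr0n.
    by rewrite pevalD pevalZ peval_sqdist yr q'0 // add0r.
  have : 0 <= h * enorm (x - c) ^+ 2 by rewrite mulr_ge0 ?sqr_ge0 // ltW.
  lra.
move=> x xc; apply/eqP; rewrite eq_le le0 //= -oppr_le0 -pevalN le0 //.
  by rewrite lapN lq oppr0.
by move=> y yr; rewrite pevalN q0 ?oppr0.
Qed.

Lemma mderiv_peval0 (R : realType) n (p : mpoly n R) (c : 'rV[R]_n) (r : R) i :
  (forall x, enorm (x - c) < r -> peval p x = 0) ->
  forall x, enorm (x - c) < r -> peval (mderiv i p) x = 0.
Proof.
move=> p0 x xc; rewrite -dirderiv_delta.
have [] // := @local_max_dirderiv R n p x (delta_mx ord0 i).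
apply/nbhs_enormP; exists (r - enorm (x - c)); first by rewrite subr_gt0.
by move=> y yx; rewrite !p0 //; have := enorm_triangle y x c; lra.
Qed.

(** Induction on the degree: the derivatives vanish on the ball too, hence are
    zero, and only the constant coefficient is left. *)
Lemma mpoly_eq0_on_ball (R : realType) n (p : mpoly n R) (c : 'rV[R]_n) (r : R) :
  0 < r -> (forall x, enorm (x - c) < r -> peval p x = 0) -> p = 0.
Proof.
move=> r0; have [N le_pN] : exists N, forall m, (N <= mdeg m)%N -> mcoeff m p = 0.
  by exists (mmeasure mdeg p) => m /msize_mdeg_ge/memN_msupp_eq0.
elim: N p le_pN => [|N IH] p le_pN p0; first by apply/mpolyP => m; rewrite mcoeff0 le_pN.
have coef m : m != mnm0 -> mcoeff m p = 0.
  move=> m0; have [i mi] : exists i, m i != 0%N.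
    apply/existsP; apply: contraNT m0; rewrite negb_exists => /forallP h.
    by apply/eqP/mnmP => i; rewrite mnm0E; apply/eqP; have := h i; rewrite negbK.
  have d0 : mderiv i p = 0.
    apply: IH; last exact: mderiv_peval0.
    by move=> k kN; rewrite mcoeff_mderiv le_pN ?mul0rn // mdegD mdeg1 addn1.
  have /(congr1 (mcoeff (mnm_sub m (mnm1 i)))) := d0.
  rewrite mcoeff_mderiv mcoeff0 submK ?lep1mP // => /eqP.
  by rewrite mulrn_eq0 /= => /eqP.
have pC : p = mpolyC n (mcoeff mnm0 p).
  apply/mpolyP => m; rewrite mcoeffC; have [->|m0] := eqVneq m mnm0; first by rewrite mulr1.
  by rewrite mulr0 coef.
have := p0 c; rewrite subrr enorm0 => /(_ r0); rewrite pC pevalC => p00.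
by rewrite p00 mpolyC0.
Qed.

Lemma msize_mderiv (R : realType) n (p : mpoly n R) i :
  (mmeasure mdeg (mderiv i p) <= (mmeasure mdeg p).-1)%N.
Proof.
rewrite [X in (X <= _)%N]mmeasureE; apply/bigmax_leqP_seq => m mp _.
have : mnm_add m (mnm1 i) \in msupp p.
  move: mp; rewrite !mcoeff_msupp mcoeff_mderiv; apply: contra => /eqP ->.
  by rewrite mul0rn.
by move/msize_mdeg_lt; rewrite mdegD mdeg1 addn1; case: (mmeasure _ p).
Qed.

Lemma msize_lap (R : realType) n (p : mpoly n R) :
  (mmeasure mdeg (lap p) <= (mmeasure mdeg p).-2)%N.
Proof.
apply: leq_trans (mmeasure_sum _ _ _ _) _; apply/bigmax_leqP => i _.
apply: leq_trans (msize_mderiv _ _) _.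
by have := msize_mderiv p i; case: (mmeasure _ p) (mmeasure _ _) => [|[|k]] [|j] //=.
Qed.

Lemma msize_sqdist (R : realType) n (c : 'rV[R]_n) :
  (mmeasure mdeg (sqdist c) <= 3)%N.
Proof.
apply: leq_trans (mmeasure_sum _ _ _ _) _; apply/bigmax_leqP => i _.
set a := _ - _; have a2 : (mmeasure mdeg a <= 2)%N.
  apply: leq_trans (mmeasureD_le _ _ _) _; rewrite geq_max mmeasureN mmeasureC.
  by rewrite msizeX mdeg1; case: (_ == _).
have [->|a0] := eqVneq a 0; first by rewrite expr0n mmeasure0.
by rewrite expr2 msizeM //; case: (mmeasure _ a) a2 => [|[|[|]]].
Qed.

(** Solving the Dirichlet problem on a ball for polynomial data by linear
    algebra: with [b] vanishing on the sphere, [p |-> lap (b * p)] maps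
    polynomials of bounded degree to themselves, and is injective because
    [b * p] is zero on the sphere.  Hence [lap (b * p) = lap g] has a solution,
    and [g - b * p] is harmonic with the values of [g] on the sphere. *)
Lemma dirichlet_mpoly (R : realType) n (g : mpoly n R) (c : 'rV[R]_n) (r : R) :
  (0 < n)%N -> 0 < r ->
  exists2 h : mpoly n R, lap h = 0 &
    forall x, enorm (x - c) = r -> peval h x = peval g x.
Proof.
move=> n0 r0; pose b : mpoly n R := mpolyC n (r ^+ 2) - sqdist c.
have b_sphere x : enorm (x - c) = r -> peval b x = 0.
  by move=> xr; rewrite pevalD pevalN pevalC peval_sqdist xr subrr.
have msb : (mmeasure mdeg b <= 3)%N.
  apply: leq_trans (mmeasureD_le _ _ _) _; rewrite geq_max mmeasureN msize_sqdist mmeasureC.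
  by case: (_ == _).
pose T (p : mpoly n R) := lap (b * p).
have TD p q : T (p + q) = T p + T q by rewrite /T mulrDr lapD.
have T0 : T 0 = 0 by rewrite /T mulr0 lap0.
have TZ a p : T (a *: p) = a *: T p by rewrite /T -scalerAr lapZ.
have msT p : (mmeasure mdeg (T p) <= mmeasure mdeg p)%N.
  have [->|p0] := eqVneq p 0; first by rewrite /T mulr0 lap0 mmeasure0.
  have [b0|b0] := eqVneq b 0; first by rewrite /T b0 mul0r lap0 mmeasure0.
  apply: leq_trans (msize_lap _) _; rewrite msizeM //.
  by rewrite -!subn1 -!subnDA leq_subLR leq_add2r.
have Tinj p : T p = 0 -> p = 0.
  move=> Tp; apply: (mpoly_eq0_on_ball r0 (c := c)) => x xr.
  have : peval (b * p) x = 0.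
    apply: (harmonic_eq0 n0 Tp) (ltW xr) => y yr.
    by rewrite pevalM b_sphere ?mul0r.
  rewrite pevalM => /eqP; rewrite mulf_eq0 => /orP[|/eqP //].
  rewrite pevalD pevalN pevalC peval_sqdist subr_eq0 => /eqP rx.
  move: xr; rewrite -(ltr_pXn2r (ltn0Sn 1)) ?nnegrE ?enorm_ge0 ?ltW // rx.
  by rewrite ltxx.
pose N := mmeasure mdeg g; pose I : finType := bmultinom n N.
pose m (i : 'I_#|I|) : multinom n := enum_val i.
have m_inj : injective m by move=> i j /val_inj/enum_val_inj.
have m_surj k : (mdeg k < N)%N -> exists i, m i = k.
  by move=> kN; exists (enum_rank (BMultinom kN)); rewrite /m enum_rankK.
pose P (v : 'rV[R]_#|I|) : mpoly n R := \sum_i v ord0 i *: mpolyX R (m i).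
have coefP v i : mcoeff (m i) (P v) = v ord0 i.
  rewrite raddf_sum (bigD1 i) //= mcoeffZ mcoeffX eqxx mulr1 big1 ?addr0 // => j ji.
  by rewrite mcoeffZ mcoeffX (inj_eq m_inj) (negPf ji) mulr0.
have P_ext (p q : mpoly n R) : (mmeasure mdeg p <= N)%N -> (mmeasure mdeg q <= N)%N ->
    (forall i, mcoeff (m i) p = mcoeff (m i) q) -> p = q.
  move=> pN qN eqpq; apply/mpolyP => k; have [kN|kN] := ltnP (mdeg k) N.
    by have [i <-] := m_surj k kN.
  by rewrite !memN_msupp_eq0 //; apply: msize_mdeg_ge; apply: leq_trans kN.
have msP v : (mmeasure mdeg (P v) <= N)%N.
  apply: leq_trans (mmeasure_sum _ _ _ _) _; apply/bigmax_leqP => i _.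
  have [->|vi] := eqVneq (v ord0 i) 0; first by rewrite scale0r mmeasure0.
  by rewrite mmeasureZ // msizeX /m bmdeg.
pose A : 'M[R]_#|I| := \matrix_(i, j) mcoeff (m j) (T (mpolyX R (m i))).
have mulA v j : (v *m A) ord0 j = mcoeff (m j) (T (P v)).
  rewrite /P (big_morph T TD T0).
  rewrite (raddf_sum (mcoeff (m j))) mxE; apply: eq_bigr => i _.
  by rewrite TZ /= mcoeffZ mxE.
have msTP v : (mmeasure mdeg (T (P v)) <= N)%N := leq_trans (msT _) (msP v).
have A_unit : A \in unitmx.
  rewrite -row_free_unit; apply: inj_row_free => v vA.
  have : P v = 0.
    apply: Tinj; apply: P_ext => [|| i]; [exact: msTP|by rewrite mmeasure0|].
    by rewrite -mulA vA mxE mcoeff0.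
  by move=> Pv; apply/rowP => i; rewrite -coefP Pv mcoeff0 mxE.
pose t : 'rV[R]_#|I| := \row_j mcoeff (m j) (lap g).
have Tt : T (P (t *m invmx A)) = lap g.
  apply: P_ext => [|| j]; first exact: msTP.
    by apply: leq_trans (msize_lap _) _; rewrite -!subn1 -subnDA leq_subr.
  by rewrite -mulA mulmxKV // mxE.
exists (g - b * P (t *m invmx A)); first by rewrite lapB -/(T _) Tt subrr.
by move=> x xr; rewrite pevalD pevalN pevalM b_sphere // mul0r subr0.
Qed.

Lemma harmonic_approx (R : realType) n (f : 'rV[R]_n -> R) (c : 'rV[R]_n) (r L d : R) :
  (0 < n)%N -> 0 < r -> 0 <= L -> 0 < d ->
  (forall x y, cube c r x -> cube c r y -> `|f x - f y| <= L * enorm (x - y)) ->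
  exists2 h : mpoly n R, lap h = 0 &
    forall x, enorm (x - c) = r -> `|peval h x - f x| <= d.
Proof.
move=> n0 r0 L0 d0 lipf; have [g hg] := weierstrass_lipschitz r0 L0 d0 lipf.
have [h lh hgh] := dirichlet_mpoly g c n0 r0; exists h => // x xr.
by rewrite hgh //; apply/hg/cball_sub_cube; rewrite /cball /= xr.
Qed.

(** * Viscosity sub- and superharmonic functions *)

(** Polynomials are the only test functions: their derivatives are computed
    algebraically and they are stable under affine changes of variable. *)
Definition subharmonic_in (R : realType) n (D : set 'rV[R]_n) (w : 'rV[R]_n -> R) :=
  forall p x, D x -> local_max (fun y => w y - peval p y) x -> 0 <= peval (lap p) x.

Definition superharmonic_in (R : realType) n (D : set 'rV[R]_n) (v : 'rV[R]_n -> R) :=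
  forall p x, D x -> local_min (fun y => v y - peval p y) x -> peval (lap p) x <= 0.

(** Superharmonicity tested only by polynomials of slope at least [b].  A
    bounded right-hand side gives no control of the Laplacian where the gradient
    is small. *)
Definition superharmonic_where_steep (R : realType) n (D : set 'rV[R]_n) (b : R)
    (v : 'rV[R]_n -> R) :=
  forall p x, D x -> local_min (fun y => v y - peval p y) x ->
    b ^+ 2 <= peval (grad_sqr p) x -> peval (lap p) x <= 0.

(** Viscosity inequalities for [w] and [V] cannot be subtracted pointwise.
    Instead a harmonic polynomial [h] that almost equals [V] on the sphere is
    compared with each of them: [V] is nearly above [h] at the centre, and [w] is
    below [h + P] there by a margin that the strict superharmonicity of [P]
    makes larger than the error. *)
Lemma strict_touching_sub_super (R : realType) n (w V : 'rV[R]_n -> R) (P : mpoly n R)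
    (c : 'rV[R]_n) (r L k : R) :
  (0 < n)%N -> 0 < r -> 0 <= L -> 0 < k -> continuous w -> continuous V ->
  (forall x y, cube c r x -> cube c r y -> `|V x - V y| <= L * enorm (x - y)) ->
  subharmonic_in (eball c r) w -> superharmonic_in (eball c r) V ->
  lap P = mpolyC n (- k) ->
  (forall x, cball c r x -> w x <= V x + peval P x) ->
  w c < V c + peval P c.
Proof.
move=> n0 r0 L0 k0 cw cV lipV subw superV lapP le_wV.
have nR : (0 : R) < n%:R by rewrite ltr0n.
pose a := k / (4 * n%:R); have a0 : 0 < a by rewrite divr_gt0 ?mulr_gt0.
have an : 2 * (a * n%:R) = k / 2 by rewrite /a; field; rewrite gt_eqF.
clearbody a.
have ar0 : 0 < a * r ^+ 2 by rewrite mulr_gt0 ?exprn_gt0.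
have [h lh hV] := harmonic_approx n0 r0 L0 (divr_gt0 ar0 (ltr0n _ 4)) lipV.
have c_in : cball c r c by exact/cball_center/ltW.
have Vc : peval h c <= V c + a * r ^+ 2 / 2.
  have cont : continuous (fun x => peval (h + (a / 4) *: sqdist c) x - V x).
    by move=> x; apply: continuousB; [exact: peval_continuous|exact: cV].
  have := le_sphere (r := r) (A := a * r ^+ 2 / 2) cont _ _ c_in.
  rewrite pevalD pevalZ peval_sqdist subrr enorm0 expr0n mulr0 addr0.
  move=> le; suff : peval h c - V c <= a * r ^+ 2 / 2 by lra.
  apply: le => x xr.
    move=> hmax.
    have hmin : local_min (fun y => V y - peval (h + (a / 4) *: sqdist c) y) x.
      by apply: filterS hmax => y; lra.
    have := superV _ x xr hmin.
    by rewrite lapD lh add0r lapZ lap_sqdist pevalZ pevalC; lra.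
  rewrite pevalD pevalZ peval_sqdist xr.
  by have := hV x xr; rewrite ler_norml => /andP[_]; lra.
have cont : continuous (fun x => w x - peval (h + P + a *: sqdist c) x).
  by move=> x; apply: continuousB; [exact: cw|exact: peval_continuous].
have := le_sphere (r := r) (A := - (3 / 4 * (a * r ^+ 2))) cont _ _ c_in.
rewrite !pevalD pevalZ peval_sqdist subrr enorm0 expr0n mulr0 addr0 => le.
suff : w c - (peval h c + peval P c) <= - (3 / 4 * (a * r ^+ 2)) by lra.
apply: le => x xr.
  move=> hmax; have := subw _ x xr hmax.
  by rewrite !lapD lh add0r lapP lapZ lap_sqdist pevalD pevalZ !pevalC; lra.
rewrite !pevalD pevalZ peval_sqdist xr.
have := le_wV x; rewrite /cball /= xr => /(_ (lexx _)).
by have := hV x xr; rewrite ler_norml => /andP[+ _]; lra.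
Qed.

Lemma uniformly_continuous_on_cball (R : realType) n (v : 'rV[R]_n -> R) (c : 'rV[R]_n) (r e : R) :
  continuous v -> 0 < e ->
  exists2 d, 0 < d & forall y z, cball c r y -> enorm (y - z) < d -> `|v y - v z| < e.
Proof.
move=> cv e0; have e2 : 0 < e / 2 by rewrite divr_gt0.
have /compact_near_coveringP cov := @cball_compact R n c r.
pose P (d : R) (y : 'rV[R]_n) := forall z, enorm (y - z) < d -> `|v y - v z| < e.
have near0 : \forall d \near 0^'+, cball c r `<=` P d.
  apply: cov => y yc; have /continuous_enormP/(_ _ e2)[d d0 hd] := cv y.
  have dh : 0 < d / 2 by rewrite divr_gt0.
  exists (eball y (d / 2), [set t | t < d / 2]).
    split=> /=; first by apply/nbhs_enormP; exists (d / 2).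
    exact: nbhs_right_lt.
  move=> [x t] /= [xy td] z xz; rewrite /eball /= in xy.
  have tri := enorm_triangle z x y; rewrite (enorm_distC z x) in tri.
  have h1 : `|v x - v y| < e / 2 by apply: hd; lra.
  have h2 : `|v z - v y| < e / 2 by apply: hd; lra.
  by have := ler_normB (v x - v y) (v z - v y); rewrite opprB addrA subrK; lra.
have /filter_ex[d [d0 hd]] : \forall d \near 0^'+, 0 < d /\ cball c r `<=` P d.
  by apply: filterI near0; exact: nbhs_right_gt.
by exists d => // y z /hd; exact.
Qed.

(** * Inf-convolution *)

Definition moreau (R : realType) (n : nat) (v : 'rV[R]_n -> R) (tau : R)
    (y z : 'rV[R]_n) : R := v z + enorm (y - z) ^+ 2 / (2 * tau).

(** [vt] is the inf-convolution of [v] over [K] at scale [tau], and [prox] a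
    choice of points where the infimum is attained. *)
Definition is_inf_convolution (R : realType) (n : nat) (K : set 'rV[R]_n)
    (v : 'rV[R]_n -> R) (tau : R) (vt : 'rV[R]_n -> R) (prox : 'rV[R]_n -> 'rV[R]_n) :=
  forall y, [/\ K (prox y), vt y = moreau v tau y (prox y)
              & forall z, K z -> vt y <= moreau v tau y z].

Lemma inf_convolution (R : realType) n (K : set 'rV[R]_n) (v : 'rV[R]_n -> R) (tau : R) :
  K !=set0 -> compact K -> continuous v ->
  exists (vt : 'rV[R]_n -> R) (prox : 'rV[R]_n -> 'rV[R]_n),
    is_inf_convolution K v tau vt prox.
Proof.
move=> K0 cK cv.
have min y : exists z, K z /\ forall z', K z' -> moreau v tau y z <= moreau v tau y z'.
  have cont : {within K, continuous (moreau v tau y)}.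
    have -> : moreau v tau y = v + peval ((2 * tau)^-1 *: sqdist y).
      apply/funext => z; rewrite /moreau -[RHS]/(v z + peval _ z).
      by rewrite pevalZ peval_sqdist enorm_distC mulrC.
    by apply: continuous_subspaceT => z; apply: continuousD; [exact: cv|exact: peval_continuous].
  have [z /set_mem Kz hz] := compact_EVT_min K0 cK cont.
  by exists z; split=> // z' Kz'; apply/hz/mem_set.
have [prox hprox] := choice min.
exists (fun y => moreau v tau y (prox y)), prox => y.
by have [Kz hz] := hprox y; split.
Qed.

Lemma moreau_shift (R : realType) n (v : 'rV[R]_n -> R) (tau : R)
    (y y' z : 'rV[R]_n) :
  moreau v tau y' z =
  moreau v tau y z + (2 * dot (y - z) (y' - y) + enorm (y' - y) ^+ 2) / (2 * tau).
Proof.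
rewrite /moreau -addrA -mulrDl; congr (_ + _ / _).
have -> : y' - z = (y - z) + (y' - y) by apply/rowP => i; rewrite !mxE; ring.
by rewrite !enorm_sqr (dotDl (y - z)) !(dotDr _ (y - z)) (dotC (y' - y) (y - z)); ring.
Qed.

(** The minimizing point for [y] competes at [y'], which bounds the increment of
    the inf-convolution by that of the quadratic term. *)
Lemma inf_convolution_lipschitz (R : realType) n (K : set 'rV[R]_n) (v vt : 'rV[R]_n -> R)
    (prox : 'rV[R]_n -> 'rV[R]_n) (tau : R) :
  0 < tau -> K `<=` cball 0 1 ->
  is_inf_convolution K v tau vt prox ->
  forall (B : R) y y', enorm y <= B -> enorm y' <= B ->
  `|vt y - vt y'| <= (2 * B + 1) / tau * enorm (y - y').
Proof.
move=> tau0 K1 hvt B.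
have half y y' : enorm y <= B -> enorm y' <= B ->
    vt y' - vt y <= (2 * B + 1) / tau * enorm (y - y').
  move=> yB y'B; have [Kz -> _] := hvt y; have [_ _ /(_ _ Kz)] := hvt y'.
  rewrite (moreau_shift _ _ y) => le; have z1 := K1 _ Kz; rewrite /cball /= subr0 in z1.
  set z := prox y in le z1 *.
  have b1 := cauchy_schwarz (y - z) (y' - y).
  have b2 : enorm (y - z) <= B + 1.
    by apply: le_trans (enormD _ _) _; rewrite enormN lerD.
  have b3 : enorm (y' - y) <= 2 * B.
    by apply: le_trans (enormD _ _) _; rewrite enormN; lra.
  have e0 := enorm_ge0 (y' - y).
  apply: (@le_trans _ _ ((2 * dot (y - z) (y' - y) + enorm (y' - y) ^+ 2) / (2 * tau)));
      first by lra.
  rewrite ler_pdivrMr ?mulr_gt0 // (enorm_distC y y').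
  rewrite (_ : _ / tau * _ * _ = (2 * (2 * B + 1)) * enorm (y' - y)); last by field; rewrite gt_eqF.
  have m1 : enorm (y - z) * enorm (y' - y) <= (B + 1) * enorm (y' - y) by rewrite ler_wpM2r.
  have m2 : enorm (y' - y) ^+ 2 <= 2 * B * enorm (y' - y) by rewrite expr2 ler_wpM2r.
  lra.
move=> y y' yB y'B; rewrite ler_norml; apply/andP; split.
  by have := half y y' yB y'B; lra.
by have := half y' y y'B yB; rewrite enorm_distC; lra.
Qed.

(** With [z] the minimizing point for [y], translation by [y - z] turns a test
    function for the inf-convolution at [y] into one for [v] at [z]; and the
    quadratic [fun x => moreau v tau x z], which touches the inf-convolution from
    above at [y], forces the gradient of the test function to be
    [(y - z) / tau]. *)
Lemma inf_convolution_touching (R : realType) n (K D : set 'rV[R]_n) (v vt : 'rV[R]_n -> R)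
    (prox : 'rV[R]_n -> 'rV[R]_n) (tau b : R) (p : mpoly n R) (y : 'rV[R]_n) :
  0 < tau -> superharmonic_where_steep D b v ->
  is_inf_convolution K v tau vt prox ->
  0 <= b -> nbhs (prox y) K -> D (prox y) -> b * tau <= enorm (y - prox y) ->
  local_min (fun x => vt x - peval p x) y -> peval (lap p) y <= 0.
Proof.
move=> tau0 steep hvt b0 nK Dz by_ ymin; have [Kz vty hz] := hvt y;
    set z := prox y in Dz by_ nK Kz vty hz *.
have t20 : 2 * tau != 0 by rewrite gt_eqF // mulr_gt0.
have grad i : peval (mderiv i p) y = (y - z) ord0 i / tau.
  have : local_max (peval (p - (2 * tau)^-1 *: sqdist z)) y.
    apply: filterS ymin => x; rewrite !pevalD !pevalN !pevalZ !peval_sqdist => le.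
    have [_ _ /(_ _ Kz)] := hvt x; move: le; rewrite vty /moreau.
    rewrite !(mulrC (2 * tau)^-1); lra.
  move=> /(local_max_dirderiv (delta_mx ord0 i))[+ _]; rewrite dirderiv_delta.
  rewrite mderivB mderivZ mderiv_sqdist !pevalE !mxE => /eqP; rewrite subr_eq0 => /eqP ->.
  by field; rewrite gt_eqF.
have AA : (1%:M : 'M[R]_n)^T *m 1%:M = 1%:M by rewrite trmx1 mulmx1.
pose q := affcomp 1%:M (y - z) p.
have qE x : peval q x = peval p (x + (y - z)) by rewrite peval_affcomp mulmx1.
have yz : z + (y - z) = y by rewrite addrC subrK.
have := steep q z Dz; rewrite /q (lap_affcomp _ _ AA) (grad_sqr_affcomp _ _ AA) !scale1r.
rewrite !peval_affcomp !mulmx1 yz; apply.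
- move/nbhs_enormP: ymin => [e e0 he]; move/nbhs_enormP: nK => [e' e'0 he'].
  apply/nbhs_enormP; exists (Num.min e e'); first by rewrite lt_min e0.
  move=> x; rewrite lt_min => /andP[xe xe']; rewrite !peval_affcomp !mulmx1 yz.
  have xy : x + (y - z) - y = x - z by apply/rowP => i; rewrite !mxE; ring.
  have := he (x + (y - z)); rewrite xy => /(_ xe).
  have [_ _ /(_ x (he' x xe'))] := hvt (x + (y - z)).
  by rewrite vty /moreau addrAC subrr add0r; lra.
- rewrite peval_sum (eq_bigr (fun i => tau^-1 ^+ 2 * ((y - z) ord0 i * (y - z) ord0 i)));
    last first.
    by move=> i _; rewrite pevalM grad expr2; ring.
  rewrite -mulr_sumr -/(dot _ _) -enorm_sqr -exprMn lerXn2r ?nnegrE ?mulr_ge0 ?invr_ge0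
      ?enorm_ge0 ?(ltW tau0) //.
  by rewrite mulrC ler_pdivlMr.
Qed.

Lemma inf_convolution_continuous (R : realType) n (K : set 'rV[R]_n) (v vt : 'rV[R]_n -> R)
    (prox : 'rV[R]_n -> 'rV[R]_n) (tau : R) :
  0 < tau -> K `<=` cball 0 1 ->
  is_inf_convolution K v tau vt prox ->
  continuous vt.
Proof.
move=> tau0 K1 hvt y; apply/continuous_enormP => e e0.
pose B := enorm y + 1; pose C := (2 * B + 1) / tau.
have B0 : 0 <= B by rewrite addr_ge0 ?enorm_ge0.
have C0 : 0 <= C by apply: divr_ge0; [lra|exact: ltW].
exists (Num.min 1 (e / (C + 1))); first by rewrite lt_min ltr01 divr_gt0 // ltr_wpDl.
move=> z; rewrite lt_min ltr_pdivlMr ?ltr_wpDl // => /andP[z1 ze].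
have zB : enorm z <= B.
  by rewrite -(subrK y z) /B addrC; apply: le_trans (enormD _ _) _; rewrite lerD2l ltW.
have yB : enorm y <= B by rewrite lerDl.
apply: le_lt_trans (inf_convolution_lipschitz tau0 K1 hvt zB yB) _.
by rewrite -/C; have := enorm_ge0 (z - y); lra.
Qed.

(** By [moreau_shift] a minimizing point within [tau] of [y] lets [vt] grow with
    slope about 1 only, so for [y] near [y0] it contradicts the growth at
    [y0 + t *: e].  This is where semiconcavity enters: it turns a lower bound
    at the single point [y0] into a bound on the slopes all around it. *)
Lemma inf_convolution_steep (R : realType) n (v vt : 'rV[R]_n -> R)
    (prox : 'rV[R]_n -> 'rV[R]_n) (tau s : R) (y0 e : 'rV[R]_n) :
  0 < tau -> tau <= 1 -> 0 < s ->
  is_inf_convolution (cball 0 1) v tau vt prox ->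
  enorm y0 <= 7 / 8 -> enorm e = 1 ->
  (forall t, 0 <= t <= s -> vt y0 + 8 * t <= vt (y0 + t *: e)) ->
  exists2 rho, 0 < rho & forall y, enorm (y - y0) < rho -> tau <= enorm (y - prox y).
Proof.
move=> tau0 tau1 s0 hvt y0_le e1 grow.
pose t := Num.min s tau.
have t0 : 0 < t by rewrite lt_min s0.
have ts : t <= s by rewrite ge_min lexx.
have tt : t <= tau by rewrite ge_min lexx orbT.
clearbody t.
exists (t * tau / 8) => [|y yy0]; first by rewrite divr_gt0 ?mulr_gt0.
rewrite leNgt; apply/negP => near.
have r_t : t * tau / 8 <= t / 8 by rewrite ler_wpM2r // ler_piMr // ltW.
have y_le : enorm y <= 1.
  rewrite -(subrK y0 y); apply: le_trans (enormD _ _) _; lra.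
have := grow t; rewrite ts (ltW t0) => /(_ isT).
have [Kz _ _] := hvt y; have [_ vty _] := hvt y; set z := prox y in Kz vty near.
set y' := y0 + t *: e; have [_ _ /(_ z Kz)] := hvt y'.
rewrite (moreau_shift _ _ y) -vty.
have y0_1 : enorm y0 <= 1 by lra.
have := inf_convolution_lipschitz tau0 (fun _ => id) hvt y_le y0_1.
rewrite ler_norml => /andP[_ lip].
have {}lip : vt y - vt y0 <= 3 / 8 * t.
  apply: le_trans lip _; rewrite mulrAC ler_pdivrMr //; lra.
set N := enorm (y' - y).
have N0 : 0 <= N by exact: enorm_ge0.
have N_le : N <= 9 / 8 * t.
  have -> : N = enorm ((y0 - y) + t *: e) by congr enorm; rewrite addrAC.
  by apply: le_trans (enormD _ _) _; rewrite enormZ e1 gtr0_norm // (enorm_distC y0); lra.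
have dot_le : dot (y - z) (y' - y) <= tau * N.
  by apply: le_trans (cauchy_schwarz _ _) _; rewrite ler_wpM2r // ltW.
have N2 : N ^+ 2 <= 2 * (t * tau).
  apply: (@le_trans _ _ ((9 / 8 * t) ^+ 2)); first by rewrite lerXn2r ?nnegrE //; lra.
  by have := ler_wpM2l (ltW t0) tt; have := sqr_ge0 t; lra.
have q_le : (2 * dot (y - z) (y' - y) + N ^+ 2) / (2 * tau) <= N + t.
  by rewrite ler_pdivrMr ?mulr_gt0 //; lra.
lra.
Qed.

(** * Doubling of variables *)

Definition reflection (R : realType) n (e : 'rV[R]_n) : 'M[R]_n :=
  1%:M - 2 *: (e^T *m e).

Lemma mul_reflection (R : realType) n (e x : 'rV[R]_n) :
  x *m reflection e = x - (2 * dot x e) *: e.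
Proof.
rewrite /reflection mulmxBr mulmx1 -scalemxAr mulmxA; congr (_ - _).
have -> : x *m e^T = (dot x e)%:M.
  by apply/matrixP => i j; rewrite !ord1 !mxE eqxx mulr1n; apply: eq_bigr => k _; rewrite !mxE.
by rewrite mul_scalar_mx scalerA.
Qed.

Lemma reflectionK (R : realType) n (e x : 'rV[R]_n) :
  dot e e = 1 -> x *m reflection e *m reflection e = x.
Proof.
move=> e1; rewrite !mul_reflection !dotE e1; apply/rowP => i; rewrite !mxE; ring.
Qed.

Lemma tr_reflection (R : realType) n (e : 'rV[R]_n) : (reflection e)^T = reflection e.
Proof.
rewrite /reflection linearB /= trmx1; congr (_ - _).
by rewrite linearZ /= trmx_mul trmxK.
Qed.

Lemma reflection_isometry (R : realType) n (e x : 'rV[R]_n) :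
  dot e e = 1 -> enorm (x *m reflection e) = enorm x.
Proof.
move=> e1; rewrite !enormE mul_reflection; congr Num.sqrt.
by rewrite dotBl !dotBr !dotZl !dotZr e1 (dotC e x); ring.
Qed.

Lemma reflection_orthogonal (R : realType) n (e : 'rV[R]_n) :
  dot e e = 1 -> (reflection e)^T *m reflection e = 1%:M.
Proof.
move=> e1; rewrite tr_reflection -[LHS]mul1mx; apply/row_matrixP => i.
by rewrite row_mul mulmxA reflectionK.
Qed.

(** Off the diagonal the doubled function has no interior maximum [(xb, hb)].
    There [vt] grows with slope at least 8 from [xb + hb] towards [xb], so [v] is
    superharmonic at the points that matter.  Comparing [w] at [x] with [vt] at
    the mirror image of [x] in the hyperplane bisecting [xb] and [xb + hb], the
    separation varies only in the normal direction and four times the second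
    derivative of [phi] enters the Laplacian; [M] makes it outweigh the
    localizing term [16 |x - x0| ^ 2]. *)
Lemma no_interior_maximum (R : realType) n (w v vt : 'rV[R]_n -> R)
    (prox : 'rV[R]_n -> 'rV[R]_n) (tau M th : R) (x0 xb hb : 'rV[R]_n) :
  let phi s := (8 + M) * s - M * s ^+ 2 in
  (0 < n)%N -> M = 16 * n%:R -> 0 < tau -> tau <= 1 -> continuous w ->
  subharmonic_in (eball 0 1) w -> superharmonic_where_steep (eball 0 1) 1 v ->
  is_inf_convolution (cball 0 1) v tau vt prox ->
  (forall y, enorm y <= 1 -> enorm (y - prox y) <= 1 / 16) ->
  (forall x h, enorm (x - x0) <= 1 / 4 -> enorm h <= 1 / 8 ->
    w x - vt (x + h) - phi (enorm h) - 16 * enorm (x - x0) ^+ 2 <= th) ->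
  th = w xb - vt (xb + hb) - phi (enorm hb) - 16 * enorm (xb - x0) ^+ 2 ->
  enorm x0 <= 1 / 2 -> enorm (xb - x0) < 1 / 4 -> 0 < enorm hb -> enorm hb < 1 / 8 ->
  False.
Proof.
move=> phi n0 ME tau0 tau1 cw subw superv hvt near16 Fmax thE x0_le xb_lt s_gt0 s_lt.
have nR : (1 : R) <= n%:R by rewrite ler1n.
set s := enorm hb in s_gt0 s_lt thE.
have xb_le : enorm xb <= 3 / 4.
  by rewrite -(subrK x0 xb); apply: le_trans (enormD _ _) _; lra.
pose yb := xb + hb; pose e := - (s^-1 *: hb).
have yb_le : enorm yb <= 7 / 8 by apply: le_trans (enormD _ _) _; rewrite -/s; lra.
have e1 : enorm e = 1 by rewrite enormN enormZ gtr0_norm ?invr_gt0 // mulVf // gt_eqF.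
have ee : dot e e = 1 by rewrite -enorm_sqr e1 expr1n.
have hbE : hb = - (s *: e) by rewrite /e scalerN opprK scalerA divff ?gt_eqF // scale1r.
clearbody e.
(* Towards xb the inf-convolution grows with slope at least 8. *)
have grow t : 0 <= t <= s -> vt yb + 8 * t <= vt (yb + t *: e).
  move=> /andP[t0 ts].
  have hE : enorm (hb + t *: e) = s - t.
    have -> : hb + t *: e = - ((s - t) *: e) by rewrite hbE scalerBl opprB addrC.
    by rewrite enormN enormZ e1 mulr1 ger0_norm // subr_ge0.
  have st8 : s - t <= 1 / 8 by lra.
  have := Fmax xb (hb + t *: e) (ltW xb_lt); rewrite hE addrA -/yb thE /phi -/yb => /(_ st8) le.
  have {}le : vt yb + ((8 + M) * t - M * (2 * s * t - t ^+ 2)) <= vt (yb + t *: e) by lra.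
  apply: le_trans le; rewrite lerD2l.
  have : 0 <= M * (t * (1 - 2 * s)) by rewrite !mulr_ge0 //; lra.
  have : 0 <= M * t ^+ 2 by rewrite mulr_ge0 ?sqr_ge0 //; lra.
  lra.
have [rho1 rho1_gt0 steep] := inf_convolution_steep tau0 tau1 s_gt0 hvt yb_le e1 grow.
pose rho := Num.min rho1 (Num.min (1 / 32) (Num.min (s / 4) (Num.min ((1 / 8 - s) / 2) (1 /
    4 - enorm (xb - x0))))).
have : 0 < rho by rewrite /rho !lt_min rho1_gt0 /=; do ?[apply/andP; split]; lra.
have : rho <= rho1 by rewrite ge_min lexx.
have : rho <= 1 / 32 by rewrite !ge_min lexx !orbT.
have : rho <= s / 4 by rewrite !ge_min lexx !orbT.
have : rho <= (1 / 8 - s) / 2 by rewrite !ge_min lexx !orbT.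
have : rho <= 1 / 4 - enorm (xb - x0) by rewrite !ge_min lexx !orbT.
clearbody rho => rho_x rho_8 rho_s rho_32 rho_1 rho_gt0.
pose A := reflection e.
have AA : A^T *m A = 1%:M by exact: reflection_orthogonal.
pose mirror x := (x - xb) *m A + yb.
have mirrorE x : mirror x = x *m A + (yb - xb *m A) by rewrite /mirror mulmxBl -addrA (addrC (- _)).
have mirrorB x y : enorm (mirror x - mirror y) = enorm (x - y).
  rewrite -(reflection_isometry (x - y) ee) !mirrorE; congr enorm.
  by rewrite mulmxBl opprD addrACA subrr addr0.
have mirror_xb : mirror xb = yb by rewrite /mirror subrr mul0mx add0r.
have mirror_sub x : mirror x - x = - ((s + 2 * dot (x - xb) e) *: e).
  rewrite /mirror mul_reflection /yb hbE; apply/rowP => i; rewrite !mxE; ring.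
pose V x := vt (mirror x).
have cvt : continuous vt := inf_convolution_continuous tau0 (fun _ => id) hvt.
have cV : continuous V.
  move=> x; apply/continuous_enormP => eps eps0.
  have [d d0 hd] := (continuous_enormP vt (mirror x)).1 (cvt _) eps eps0.
  by exists d => // y yx; apply: hd; rewrite mirrorB.
pose B := 1 + n%:R * rho.
have B0 : 0 <= (2 * B + 1) / tau.
  by apply: divr_ge0; [have : 0 <= n%:R * rho by rewrite mulr_ge0 // ltW | exact: ltW];
      rewrite /B; lra.
have lipV x y : cube xb rho x -> cube xb rho y ->
    `|V x - V y| <= (2 * B + 1) / tau * enorm (x - y).
  move=> xc yc; rewrite -(mirrorB x y).
  have bound z : cube xb rho z -> enorm (mirror z) <= B.
    move=> zc; rewrite -(subrK yb (mirror z)); apply: le_trans (enormD _ _) _.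
    rewrite -{1}mirror_xb mirrorB addrC /B lerD //; first lra.
    apply: le_trans (enorm_le_norm _) _; rewrite ler_wpM2l //.
    rewrite {1}/Num.norm /= mx_normrE; apply: bigmax_le; first exact: ltW.
    by move=> [i j] _ /=; rewrite ord1; have := zc j; rewrite !mxE.
  by apply: (inf_convolution_lipschitz tau0 (fun _ => id) hvt); exact: bound.
have subw' : subharmonic_in (eball xb rho) w.
  move=> p x xr; apply: subw; rewrite /eball /= subr0 in xr *.
  by rewrite -(subrK xb x); apply: le_lt_trans (enormD _ _) _; lra.
have superV : superharmonic_in (eball xb rho) V.
  move=> p x xr xmin; rewrite /eball /= in xr.
  have mx_yb : enorm (mirror x - yb) < rho by rewrite -mirror_xb mirrorB.
  have mx_lt : enorm (mirror x) < 7 / 8 + 1 / 32.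
    by rewrite -(subrK yb (mirror x)); apply: le_lt_trans (enormD _ _) _; lra.
  have px_lt : enorm (prox (mirror x)) < 1.
    have mx1 : enorm (mirror x) <= 1 by lra.
    have := near16 (mirror x) mx1; rewrite enorm_distC => pr.
    by rewrite -(subrK (mirror x) (prox _)); apply: le_lt_trans (enormD _ _) _; lra.
  pose q := affcomp A (xb - yb *m A) p.
  have unmirror y : mirror (y *m A + (xb - yb *m A)) = y.
    rewrite mirrorE /A mulmxDl mulmxBl !(reflectionK _ ee); apply/rowP => i; rewrite !mxE; ring.
  have qE y : peval q (mirror y) = peval p y.
    rewrite peval_affcomp mirrorE /A mulmxDl mulmxBl !(reflectionK _ ee).
    by congr peval; apply/rowP => i; rewrite !mxE; ring.
  have -> : peval (lap p) x = peval (lap q) (mirror x).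
    rewrite (lap_affcomp _ _ AA) scale1r peval_affcomp mirrorE /A mulmxDl mulmxBl
        !(reflectionK _ ee).
    by congr peval; apply/rowP => i; rewrite !mxE; ring.
  apply: (inf_convolution_touching tau0 superv hvt ler01).
  - apply/nbhs_enormP; exists (1 - enorm (prox (mirror x))); first by rewrite subr_gt0.
    move=> y yp; rewrite /cball /= subr0 -(subrK (prox (mirror x)) y).
    by apply: le_trans (enormD _ _) _; lra.
  - by rewrite /eball /= subr0.
  - by rewrite mul1r; apply: steep; lra.
  - move/nbhs_enormP: xmin => [d d0 hd]; apply/nbhs_enormP; exists d => // y yx.
    rewrite -(unmirror y) !qE; apply: hd.
    by rewrite -(mirrorB _ x) unmirror.
pose l := linpoly (2 *: e) + mpolyC n (s - 2 * dot xb e).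
have lE x : peval l x = s + 2 * dot (x - xb) e.
  by rewrite pevalD peval_linpoly pevalC dotZl dotBl (dotC x); ring.
pose P := mpolyC n th + ((8 + M) *: l - M *: (l * l)) + 16 *: sqdist x0.
(* -8 M from the concave term, 32 n from the localizing one. *)
have lapP : lap P = mpolyC n (- (96 * n%:R)).
  have lapl : lap (l * l) = mpolyC n 8.
    rewrite /l; set b := mpolyC n _; set a := linpoly _.
    have -> : (a + b) * (a + b) = a ^+ 2 + 2 * (s - 2 * dot xb e) *: a + b * b.
      by rewrite -mul_mpolyC mpolyCM -/b mpolyCMn mpolyC1; ring.
    rewrite !lapD lapZ lap_linpoly scaler0 addr0 lap_linpoly_sqr /b -mpolyCM lapC addr0.
    by rewrite dotZl dotZr ee; congr mpolyC; ring.
  rewrite /P !lapD lapN !lapZ lapl lapD lap_linpoly !lapC lap_sqdist !add0r scaler0 add0r.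
  rewrite -!mul_mpolyC -!mpolyCM -mpolyCN -mpolyCD ME; congr mpolyC; ring.
have k0 : 0 < 96 * n%:R :> R by lra.
have lt := strict_touching_sub_super n0 rho_gt0 B0 k0 cw cV lipV subw' superV lapP.
clearbody l.
have l_ge0 x : cball xb rho x -> 0 <= s + 2 * dot (x - xb) e <= 1 / 8.
  rewrite /cball /= => xr; have := cauchy_schwarz (x - xb) e.
  have := cauchy_schwarz (- (x - xb)) e; rewrite dotNl enormN e1 mulr1 => c1 c2.
  by apply/andP; split; lra.
have hE x : cball xb rho x -> enorm (mirror x - x) = s + 2 * dot (x - xb) e.
  by move=> /l_ge0/andP[l0 _]; rewrite mirror_sub enormN enormZ e1 mulr1 ger0_norm.
have PE x : cball xb rho x ->
    peval P x = th + phi (enorm (mirror x - x)) + 16 * enorm (x - x0) ^+ 2.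
  move=> xr; rewrite hE // /P /phi !(pevalD, pevalN, pevalZ, pevalC, pevalM) lE peval_sqdist; ring.
have lt_center : w xb < V xb + peval P xb.
  apply: lt => x xr; have /andP[l0 l8] := l_ge0 x xr; rewrite PE //.
  have x4 : enorm (x - x0) <= 1 / 4.
    by apply: le_trans (enorm_triangle x xb x0) _; rewrite /cball /= in xr; lra.
  by have := Fmax x (mirror x - x) x4; rewrite addrCA subrr addr0 -/(V x) hE // => /(_ l8); lra.
move: lt_center; rewrite PE; last exact/cball_center/ltW.
have -> : mirror xb - xb = hb by rewrite mirror_xb /yb addrAC subrr add0r.
by rewrite /V mirror_xb thE -/s -/yb; lra.
Qed.

(** If the estimate failed, [w x - vt y - phi |x - y| - 16 |x - x0| ^ 2], with
    [vt] an inf-convolution of [v] close to [v], would have a positive maximum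
    over [|x - x0| <= 1 / 4], [|x - y| <= 1 / 8].  The quadratic term and [phi]
    keep the maximum away from the boundary, as [w <= 1]; and it is off the
    diagonal because [w <= v] there. *)
Lemma lipschitz_comparison (R : realType) n (w v : 'rV[R]_n -> R) (x0 y0 : 'rV[R]_n) :
  (0 < n)%N -> continuous w -> continuous v ->
  (forall x, 0 <= v x) -> (forall x, v x <= 1) -> (forall x, w x <= v x) ->
  subharmonic_in (eball 0 1) w -> superharmonic_where_steep (eball 0 1) 1 v ->
  enorm x0 <= 1 / 2 ->
  w x0 <= v y0 + (8 + 16 * n%:R) * enorm (x0 - y0).
Proof.
move=> n0 cw cv v0 v1 wv subw superv x0_le.
have nR : (1 : R) <= n%:R by rewrite ler1n.
pose M : R := 16 * n%:R; have ME : M = 16 * n%:R by []; rewrite -ME.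
have M16 : 16 <= M by lra.
rewrite leNgt; apply/negP => lt; have w1 x : w x <= 1 := le_trans (wv x) (v1 x).
pose k0 := w x0 - (v y0 + (8 + M) * enorm (x0 - y0)); have k0_gt0 : 0 < k0 by rewrite subr_gt0.
have d0_ge0 := enorm_ge0 (x0 - y0).
have d0_lt : enorm (x0 - y0) < 1 / 8.
  have := w1 x0; have := v0 y0.
  have : 16 * enorm (x0 - y0) <= M * enorm (x0 - y0) by rewrite ler_wpM2r.
  lra.
clearbody M.
(* The inf-convolution at a scale adapted to the modulus of continuity of v. *)
have [d d_gt0 unif] := @uniformly_continuous_on_cball R n v 0 1 k0 cv k0_gt0.
pose tau := Num.min ((1 / 32) ^+ 2) (d ^+ 2 / 4).
have tau0 : 0 < tau by rewrite lt_min divr_gt0 ?exprn_gt0 ?divr_gt0.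
have tau_small : tau <= (1 / 32) ^+ 2 by rewrite ge_min lexx.
have tau_d : tau <= d ^+ 2 / 4 by rewrite ge_min lexx orbT.
clearbody tau.
have K0 : cball (0 : 'rV[R]_n) 1 !=set0 by exists 0; exact: cball_center.
have [vt [prox hvt]] := inf_convolution tau K0 (@cball_compact R n 0 1) cv.
have vt0 y : 0 <= vt y.
  have [_ -> _] := hvt y; rewrite /moreau addr_ge0 // divr_ge0 ?sqr_ge0 // ltW // mulr_gt0 //.
have vt_le y : enorm y <= 1 -> vt y <= v y.
  move=> y1; have [_ _ /(_ y)] := hvt y.
  by rewrite /cball /moreau /= !subr0 subrr enorm0 expr0n mul0r addr0; apply.
have prox_near y : enorm y <= 1 -> enorm (y - prox y) ^+ 2 <= 2 * tau.
  move=> y1; have [_ E _] := hvt y; have := vt_le y y1; rewrite E /moreau => h.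
  have {h} : enorm (y - prox y) ^+ 2 / (2 * tau) <= 1 by have := v0 (prox y); have := v1 y; lra.
  by rewrite ler_pdivrMr ?mulr_gt0 // mul1r.
have vt_close y : enorm y <= 1 -> v y - k0 < vt y.
  move=> y1; have [_ E _] := hvt y; rewrite E /moreau.
  have : 0 <= enorm (y - prox y) ^+ 2 / (2 * tau).
    by rewrite divr_ge0 ?sqr_ge0 // ltW // mulr_gt0.
  have : `|v y - v (prox y)| < k0.
    apply: unif; first by rewrite /cball /= subr0.
    rewrite -(ltr_pXn2r (ltn0Sn 1)) ?nnegrE ?enorm_ge0 ?(ltW d_gt0) //.
    have := prox_near y y1; have : 0 < d ^+ 2 by rewrite exprn_gt0.
    lra.
  by rewrite ltr_norml => /andP[_]; lra.
have prox_near16 y : enorm y <= 1 -> enorm (y - prox y) <= 1 / 16.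
  move=> y1; have le2 : enorm (y - prox y) ^+ 2 <= (1 / 16) ^+ 2 by have := prox_near y y1; lra.
  by rewrite -(ler_pXn2r (ltn0Sn 1)) ?nnegrE ?enorm_ge0 ?divr_ge0.
have cvt : continuous vt := inf_convolution_continuous tau0 (fun _ => id) hvt.
pose phi (s : R) := (8 + M) * s - M * s ^+ 2.
have phi_ge0 s : 0 <= s <= 1 / 8 -> 8 * s <= phi s.
  move=> /andP[s0 s8]; rewrite /phi.
  have : 0 <= M * (s * (1 - s)) by rewrite !mulr_ge0 //; lra.
  lra.
pose F (p : 'rV[R]_n * 'rV[R]_n) := w p.1 - vt (p.1 + p.2) - phi (enorm p.2) - 16 * enorm
    (p.1 - x0) ^+ 2.
have cphi : continuous phi.
  move=> t; apply: (@continuousB _ R^o R); apply: (@continuousM R R) => //;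
      try exact: cst_continuous.
  by apply: exprn_continuous.
have cF : continuous F.
  have cfst : continuous (fst : 'rV[R]_n * 'rV[R]_n -> 'rV[R]_n) by move=> p; exact: cvg_fst.
  have csnd : continuous (snd : 'rV[R]_n * 'rV[R]_n -> 'rV[R]_n) by move=> p; exact: cvg_snd.
  have c1 : continuous (w \o (fst : 'rV[R]_n * 'rV[R]_n -> 'rV[R]_n)).
    by move=> p; apply: continuous_comp; [exact: cfst|exact: cw].
  have c2 : continuous (vt \o (fun p : 'rV[R]_n * 'rV[R]_n => p.1 + p.2)).
    move=> p; apply: continuous_comp; last exact: cvt.
    by apply: continuousD; [exact: cfst|exact: csnd].
  have c3 : continuous (phi \o ((fun h : 'rV[R]_n => enorm (h - 0)) \o (snd : 'rV[R]_n *
      'rV[R]_n -> 'rV[R]_n))).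
    move=> p; apply: continuous_comp; last exact: cphi.
    by apply: continuous_comp; [exact: csnd|exact: enorm_continuous].
  have c4 : continuous (peval (16 *: sqdist x0) \o (fst : 'rV[R]_n * 'rV[R]_n -> 'rV[R]_n)).
    by move=> p; apply: continuous_comp; [exact: cfst|exact: peval_continuous].
  have -> : F = (w \o fst) - (vt \o (fun p => p.1 + p.2))
      - (phi \o ((fun h => enorm (h - 0)) \o snd)) - (peval (16 *: sqdist x0) \o fst).
    apply/funext => p; rewrite -[RHS]/(_ - vt (p.1 + p.2) - phi (enorm (p.2 - 0)) - _ p.1).
    by rewrite /F subr0 pevalZ peval_sqdist.
  move=> p; apply: continuousB; last exact: c4.
  apply: continuousB; last exact: c3.
  by apply: continuousB; [exact: c1|exact: c2].
have AA : (cball x0 (1 / 4) `*` cball (0 : 'rV[R]_n) (1 / 8)) !=set0.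
  by exists (x0, 0); split; apply: cball_center.
have cA := compact_setX (@cball_compact R n x0 (1 / 4)) (@cball_compact R n 0 (1 / 8)).
have [[xb hb] /set_mem[/= xbA hbA] Fmax] := compact_EVT_max AA cA (continuous_subspaceT cF).
rewrite /cball /= subr0 in xbA hbA.
pose th := F (xb, hb).
have {}Fmax x h : enorm (x - x0) <= 1 / 4 -> enorm h <= 1 / 8 ->
    w x - vt (x + h) - phi (enorm h) - 16 * enorm (x - x0) ^+ 2 <= th.
  move=> x4 h8; apply: (Fmax (x, h)); apply/mem_set; split => //=.
  by rewrite /cball /= subr0.
have th_k0 : k0 <= th.
  have y0_1 : enorm y0 <= 1.
    rewrite -(subrK x0 y0); apply: le_trans (enormD _ _) _; rewrite enorm_distC; lra.
  apply: le_trans (Fmax x0 (y0 - x0) _ _); rewrite ?subrr ?enorm0 //;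
      last by rewrite enorm_distC ltW.
  rewrite (addrC x0) subrK expr0n mulr0 subr0 enorm_distC /phi.
  have := vt_le y0 y0_1; have : 0 <= M * enorm (x0 - y0) ^+ 2 by rewrite mulr_ge0 ?sqr_ge0 //; lra.
  rewrite /k0; lra.
have thE : th = w xb - vt (xb + hb) - phi (enorm hb) - 16 * enorm (xb - x0) ^+ 2 by [].
clearbody th.
have xb_le : enorm xb <= 3 / 4.
  by rewrite -(subrK x0 xb); apply: le_trans (enormD _ _) _; lra.
have hb_ge0 := enorm_ge0 hb; have xx_ge0 := enorm_ge0 (xb - x0).
have phib : 8 * enorm hb <= phi (enorm hb) by apply: phi_ge0; rewrite hb_ge0.
have xb_lt : enorm (xb - x0) < 1 / 4.
  rewrite lt_neqAle xbA andbT; apply/eqP => E; have := w1 xb; have := vt0 (xb + hb).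
  rewrite E in thE; lra.
have hb_lt : enorm hb < 1 / 8.
  rewrite lt_neqAle hbA andbT; apply/eqP => E; have := w1 xb; have := vt0 (xb + hb).
  have := sqr_ge0 (enorm (xb - x0)); lra.
have s_gt0 : 0 < enorm hb.
  rewrite lt_neqAle hb_ge0 andbT eq_sym; apply/eqP => /enorm_eq0 E.
  have xb1 : enorm xb <= 1 by lra.
  have := vt_close xb xb1; have := wv xb; have := sqr_ge0 (enorm (xb - x0)).
  by move: thE; rewrite E addr0 enorm0 /phi; lra.
have tau1 : tau <= 1 by apply: le_trans tau_small _; lra.
exact: (no_interior_maximum n0 ME tau0 tau1 cw subw superv hvt prox_near16 Fmax thE x0_le
  xb_lt s_gt0 hb_lt).
Qed.

(** * Smallness near a zero *)

Lemma mderiv_exp (R : realType) n (u : mpoly n R) k i :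
  mderiv i (u ^+ k.+1) = k.+1%:R * u ^+ k * mderiv i u.
Proof.
elim: k => [|k IH]; first by rewrite expr1 expr0 !mul1r.
by rewrite exprS mderivM IH -[k.+2%:R]natr1 exprS; ring.
Qed.

Lemma grad_sqr_exp (R : realType) n (u : mpoly n R) k :
  grad_sqr (u ^+ k.+1) = (k.+1%:R * u ^+ k) ^+ 2 * grad_sqr u.
Proof.
by rewrite mulr_sumr; apply: eq_bigr => i _; rewrite mderiv_exp; ring.
Qed.

Lemma lap_exp (R : realType) n (u : mpoly n R) k :
  lap (u ^+ k.+2) = k.+2%:R * (k.+1%:R * u ^+ k * grad_sqr u + u ^+ k.+1 * lap u).
Proof.
rewrite mulrDr !mulr_sumr -big_split; apply: eq_bigr => i _.
have dn j : mderiv i (j%:R : mpoly n R) = 0 by rewrite -mpolyC_nat mderivC.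
by rewrite mderiv_exp !mderivM dn mderiv_exp /=; ring.
Qed.

Lemma peval_nat (R : realType) n k (x : 'rV[R]_n) : peval (k%:R : mpoly n R) x = k%:R.
Proof. by rewrite -mpolyC_nat pevalC. Qed.

(** A flat version of the Harnack inequality: a function that is nearly zero at
    the centre is small on a smaller ball.  If [w x0] were large, the Lipschitz
    comparison would make [v] large on a ball around [x0], and a radial
    subsolution that has no critical point between that ball and the sphere of
    radius 1/2 would keep [v] away from zero at the centre. *)
Lemma small_near_zero (R : realType) n (delta : R) :
  (0 < n)%N -> 0 < delta -> delta <= 1 ->
  exists (b eta : R), [/\ 0 < b, 0 < eta & forall w v : 'rV[R]_n -> R,
    continuous w -> continuous v ->
    (forall x, 0 <= v x) -> (forall x, v x <= 1) -> (forall x, w x <= v x) ->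
    subharmonic_in (eball 0 1) w -> superharmonic_where_steep (eball 0 1) b v ->
    v 0 <= eta -> forall x0, enorm x0 <= 1 / 4 -> w x0 <= delta].
Proof.
move=> n0 d0 d1; have nR : (1 : R) <= n%:R by rewrite ler1n.
pose L : R := 8 + 16 * n%:R; have L0 : 16 <= L by rewrite /L; lra.
pose a := delta / (2 * L); have a0 : 0 < a by rewrite divr_gt0 //; lra.
have La : L * a = delta / 2 by rewrite /a; field; rewrite gt_eqF //; lra.
have a16 : a <= 1 / 16 by have : 16 * a <= L * a by [rewrite ler_wpM2r // ltW]; lra.
clearbody a.
have a2 : 0 < 8 * a ^+ 2 by rewrite mulr_gt0 ?exprn_gt0.
have q0 : 0 <= n%:R / (8 * a ^+ 2) by rewrite divr_ge0 // ltW.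
pose k := Num.bound (n%:R / (8 * a ^+ 2)).
have hk : n%:R <= 8 * a ^+ 2 * k.+1%:R.
  rewrite mulrC -ler_pdivrMr //; apply/ltW/(lt_le_trans (archi_boundP q0)).
  by rewrite ler_nat.
clearbody k.
pose psi0 := delta / 2 * (3 / 4) ^+ k.+2.
have psi0E : psi0 = delta / 2 * (3 / 4) ^+ k.+2 by [].
have psi0_gt0 : 0 < psi0 by rewrite mulr_gt0 ?exprn_gt0 ?divr_gt0.
have psi0_le : psi0 <= 1 / 2.
  apply: (@le_trans _ _ (delta / 2)); last lra.
  by rewrite /psi0 ler_piMr ?exprn_ile1 //; lra.
clearbody psi0.
exists (4 * a * psi0), (psi0 / 2); split; [|by rewrite divr_gt0|].
  by do 2 apply: mulr_gt0 => //.
move=> w v cw cv v0 v1 wv subw superv v_center x0 x0_le.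
rewrite leNgt; apply/negP => lt.
have lip y : delta - L * enorm (y - x0) < v y.
  have : superharmonic_where_steep (eball 0 1) 1 v.
    move=> p x Dx pmin le1; apply: (superv p x Dx pmin); apply: le_trans le1.
    rewrite lerXn2r ?nnegrE ?mulr_ge0 ?(ltW a0) ?(ltW psi0_gt0) //.
    have : a * psi0 <= 1 / 16 * (1 / 2) by apply: ler_pM; rewrite ?(ltW a0) ?(ltW psi0_gt0).
    lra.
  move=> steep1; have x0_le2 : enorm x0 <= 1 / 2 by lra.
  have := lipschitz_comparison y n0 cw cv v0 v1 wv subw steep1 x0_le2.
  by rewrite -/L enorm_distC; lra.
(* The barrier psi = (delta / 2) (1 - 4 |y - x0|^2)^(k+2) vanishes on the sphere
   of radius 1/2; for the k chosen above it is subharmonic off the ball of radius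
   a, on which v exceeds delta / 2. *)
pose u : mpoly n R := 1 - 4 *: sqdist x0.
have uE y : peval u y = 1 - 4 * enorm (y - x0) ^+ 2.
  by rewrite pevalD pevalN peval1 pevalZ peval_sqdist.
have lapu : lap u = mpolyC n (- (8 * n%:R)).
  rewrite lapB lapZ lap_sqdist -(mpolyC1 n R) lapC sub0r -mul_mpolyC -mpolyCM -mpolyCN.
  by congr mpolyC; ring.
have gradu : grad_sqr u = 64 *: sqdist x0.
  have -> : grad_sqr u = grad_sqr (- 4 *: sqdist x0).
    apply: eq_bigr => i _; rewrite /u mderivB -(mpolyC1 n R) mderivC sub0r.
    by rewrite scaleNr mderivN.
  by rewrite grad_sqrZ grad_sqr_sqdist scalerA; congr (_ *: _); ring.
clearbody u.
pose psi := (delta / 2) *: u ^+ k.+2.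
have psiE y : peval psi y = delta / 2 * (1 - 4 * enorm (y - x0) ^+ 2) ^+ k.+2.
  by rewrite pevalZ peval_exp uE.
have ball_bound y : cball x0 (1 / 2) y -> enorm (y - x0) ^+ 2 <= 1 / 4.
  rewrite /cball /= => y2; apply: (@le_trans _ _ ((1 / 2) ^+ 2)); last lra.
  by rewrite lerXn2r ?nnegrE ?enorm_ge0 ?divr_ge0.
have x0_sqr : enorm x0 ^+ 2 <= (1 / 4) ^+ 2.
  by rewrite lerXn2r ?nnegrE ?enorm_ge0 ?divr_ge0.
have psi_center : psi0 <= peval psi 0.
  rewrite psiE psi0E ler_wpM2l ?divr_ge0 ?(ltW d0) // lerXn2r ?nnegrE ?divr_ge0 //.
    by rewrite sub0r enormN; lra.
  by rewrite sub0r enormN; lra.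
have cont : continuous (fun x => peval psi x - v x).
  by move=> x; apply: continuousB; [exact: peval_continuous|exact: cv].
have ne : cball x0 (1 / 2) !=set0 by exists x0; apply: cball_center; lra.
have [y /set_mem yc ymax] :=
  compact_EVT_max ne (@cball_compact R n x0 (1 / 2)) (continuous_subspaceT cont).
have center_in : cball x0 (1 / 2) 0 by rewrite /cball /= sub0r enormN; lra.
have gap : psi0 / 2 <= peval psi y - v y by have := ymax 0 (mem_set center_in); lra.
have psi_y : psi0 / 2 <= peval psi y by have := v0 y; lra.
set q := enorm (y - x0) ^+ 2; have q_le : q <= 1 / 4 := ball_bound y yc.
have q_ge0 : 0 <= q by exact: sqr_ge0.
have u0 : 0 <= 1 - 4 * q by lra.
have u1 : 1 - 4 * q <= 1 by lra.
have y_far : a <= enorm (y - x0).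
  rewrite leNgt; apply/negP => near; have := lip y.
  have : L * enorm (y - x0) <= L * a by rewrite ler_wpM2l ?ltW //; lra.
  have : peval psi y <= delta / 2.
    by rewrite psiE -/q ler_piMr ?exprn_ile1 //; lra.
  lra.
have q_far : a ^+ 2 <= q by rewrite lerXn2r ?nnegrE ?enorm_ge0 ?(ltW a0).
have y_in : enorm (y - x0) < 1 / 2.
  rewrite lt_neqAle [X in _ && X]yc andbT; apply/eqP => E.
  by move: psi_y; rewrite psiE E (_ : 1 - _ = 0) ?expr0n ?mulr0; lra.
have ymin : local_min (fun x => v x - peval psi x) y.
  apply/nbhs_enormP; exists (1 / 2 - enorm (y - x0)); first by rewrite subr_gt0.
  move=> z zy; have zc : cball x0 (1 / 2) z.
    by rewrite /cball /=; have := enorm_triangle z y x0; lra.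
  by have := ymax z (mem_set zc); lra.
have y_dom : eball 0 1 y.
  by rewrite /eball /= subr0 -(subrK x0 y); apply: le_lt_trans (enormD _ _) _; lra.
have upos : 0 < 1 - 4 * q.
  rewrite lt_neqAle eq_sym u0 andbT; apply/eqP => E.
  by move: psi_y; rewrite psiE -/q E expr0n mulr0; lra.
have := superv psi y y_dom ymin.
have -> : peval (grad_sqr psi) y =
    (delta / 2 * (k.+2%:R * (1 - 4 * q) ^+ k.+1)) ^+ 2 * (64 * q).
  rewrite grad_sqrZ pevalZ grad_sqr_exp pevalM peval_exp pevalM peval_exp uE gradu pevalZ
      peval_sqdist -/q.
  by rewrite peval_nat mulrA -exprMn.
have -> : peval (lap psi) y = delta / 2 * (k.+2%:R * (1 - 4 * q) ^+ k *
    (k.+1%:R * (64 * q) - (1 - 4 * q) * (8 * n%:R))).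
  rewrite lapZ pevalZ lap_exp !(pevalM, pevalD, peval_exp) uE gradu lapu pevalZ
      peval_sqdist pevalC -/q.
  by rewrite !peval_nat exprS; move: (_ ^+ k) => Y; ring.
have pow_ge : psi0 / delta <= (1 - 4 * q) ^+ k.+1.
  rewrite ler_pdivrMr //; have : peval psi y <= delta / 2 * (1 - 4 * q) ^+ k.+1.
    by rewrite psiE -/q ler_wpM2l ?divr_ge0 ?(ltW d0) // exprS ler_piMl ?exprn_ge0.
  lra.
have lap_pos : 0 < delta / 2 * (k.+2%:R * (1 - 4 * q) ^+ k *
    (k.+1%:R * (64 * q) - (1 - 4 * q) * (8 * n%:R))).
  apply: mulr_gt0; first by rewrite divr_gt0.
  apply: mulr_gt0; first by rewrite mulr_gt0 ?exprn_gt0 ?ltr0n.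
  have qa : a ^+ 2 * k.+1%:R <= q * k.+1%:R by rewrite ler_wpM2r.
  have qn : 0 < q * n%:R by rewrite mulr_gt0 //; [apply: lt_le_trans q_far; rewrite exprn_gt0|lra].
  lra.
move=> le0; move: lap_pos; rewrite ltNge le0 //.
(* The gradient of the barrier where it still exceeds psi0 / 2. *)
set X := _ ^+ k.+1 in pow_ge *.
have X0 : 0 <= X by rewrite exprn_ge0.
clearbody X.
have k2 : (1 : R) <= k.+2%:R by rewrite ler1n.
rewrite (_ : _ * (64 * q) = (4 * delta * k.+2%:R * X * enorm (y - x0)) ^+ 2); last first.
  by rewrite /q; move: (k.+2%:R) (enorm _) => k' e; field.
have kX : psi0 / delta <= k.+2%:R * X by apply: le_trans pow_ge _; rewrite ler_peMl.
have p0 : 0 <= psi0 / delta by rewrite divr_ge0 ?(ltW d0) ?(ltW psi0_gt0).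
have kXa : psi0 / delta * a <= k.+2%:R * X * enorm (y - x0).
  by apply: ler_pM => //; exact: ltW.
rewrite mulrAC ler_pdivrMr // in kXa.
apply: lerXn2r; rewrite ?nnegrE.
- by rewrite !mulr_ge0 ?(ltW a0) ?(ltW psi0_gt0).
- by rewrite !mulr_ge0 ?(ltW d0) ?enorm_ge0.
- lra.
Qed.

(** * The substitution v = u `^ (1 / g) *)

(** Any positive coefficient of the square would do below.  This one comes from
    writing [s `^ g] as [s] times the square of [s `^ ((g - 1) / 2)], which is at
    least [1 + (g - 1) / 2 * (1 - s^-1)] by convexity of the exponential. *)
Lemma powR_second_order (R : realType) (g s : R) :
  1 < g -> (g - 1) / (g + 1) <= s -> s <= 2 ->
  1 + g * (s - 1) + (g - 1) ^+ 2 / 8 * (s - 1) ^+ 2 <= s `^ g.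
Proof.
move=> g1 sl s2; have s0 : 0 < s by apply: lt_le_trans sl; rewrite divr_gt0; lra.
rewrite ler_pdivrMr in sl; last lra.
pose z := (g - 1) / 2 * (1 - s^-1).
have sz : s * z = (g - 1) / 2 * (s - 1) by rewrite /z; field; rewrite gt_eqF.
have z1 : 0 <= 1 + z by rewrite -(pmulr_rge0 _ s0); lra.
have lnge : 1 - s^-1 <= ln s.
  have := expR_ge1Dx (- ln s); rewrite expRN lnK // => h; lra.
have half : 1 + z <= s `^ ((g - 1) / 2).
  rewrite /powR gt_eqF //; apply: le_trans (expR_ge1Dx _).
  by rewrite lerD2l ler_wpM2l //; lra.
have -> : s `^ g = s * (s `^ ((g - 1) / 2)) ^+ 2.
  rewrite -powR_mulrn ?powR_ge0 // -powRrM -{2}(powRr1 (ltW s0)) -powRD; first by congr powR; field.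
  by rewrite (gt_eqF s0) implybT.
have : s * (1 + z) ^+ 2 <= s * (s `^ ((g - 1) / 2)) ^+ 2.
  by rewrite ler_wpM2l ?(ltW s0) // lerXn2r ?nnegrE ?powR_ge0.
have zz : s * z ^+ 2 = ((g - 1) / 2) ^+ 2 * (s - 1) ^+ 2 / s.
  by rewrite /z; field; rewrite gt_eqF.
have : ((g - 1) / 2) ^+ 2 * (s - 1) ^+ 2 / 2 <= s * z ^+ 2.
  rewrite zz; apply: ler_wpM2l; first by rewrite mulr_ge0 ?sqr_ge0.
  by rewrite lef_pV2 ?posrE.
have -> : s * (1 + z) ^+ 2 = s + 2 * (s * z) + s * z ^+ 2 by ring.
rewrite sz; lra.
Qed.

(** The homogeneity of the equation: with [g = (2 + beta) / (1 + beta + alpha)]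
    the value [t] of [u `^ (1 / g)] drops out of the left-hand side. *)
Lemma powR_homogeneity (R : realType) (alpha beta g S r t b : R) :
  g * (1 + beta + alpha) = 2 + beta -> 0 < g -> 0 < S -> 0 < r -> 0 < t -> 0 < b ->
  (S * t `^ g) `^ alpha * (S / r * (t `^ g * g / t) * b) `^ beta *
    (S / r ^+ 2 * (t `^ g / t ^+ 2) * b ^+ 2) =
  S `^ (1 + beta + alpha) / r `^ (2 + beta) * g `^ beta * b `^ (2 + beta).
Proof.
move=> hg g0 S0 r0 t0 b0.
have log (x : R) : 0 < x -> exists l, x = expR l by move=> x0; exists (ln x); rewrite lnK.
have [G gE] := log g g0; have [s ->] := log S S0; have [rho ->] := log r r0.
have [tau ->] := log t t0; have [l ->] := log b b0.
have sq (x : R) : expR x ^+ 2 = expR (2 * x) by rewrite expRM_natl.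
rewrite -!expRM !sq.
have -> : expR s * expR (tau * g) = expR (s + tau * g) by rewrite expRD.
have -> : expR s / expR rho * (expR (tau * g) * g / expR tau) * expR l =
    expR (s - rho + (tau * g + G - tau) + l).
  by rewrite {2}gE !expRD !expRN.
have -> : expR s / expR (2 * rho) * (expR (tau * g) / expR (2 * tau)) * expR (2 * l) =
    expR (s - 2 * rho + (tau * g - 2 * tau) + 2 * l) by rewrite !expRD !expRN.
have -> : g `^ beta = expR (G * beta) by rewrite gE expRM.
rewrite -!expRM -expRN -!expRD; congr expR.
have hg' : tau * (g * (1 + beta + alpha)) = tau * (2 + beta) by rewrite hg.
lra.
Qed.

(** The polynomial [Q] seen from the ball of radius [r] about [Z], with its
    values multiplied by [S]. *)
Definition zoom (R : realType) n (Z : 'rV[R]_n) (r S : R) (Q : mpoly n R) : mpoly n R :=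
  S *: affcomp (r^-1)%:M (- (r^-1 *: Z)) Q.

Lemma zoom_pre (R : realType) n (Z Y : 'rV[R]_n) (r : R) :
  Y *m (r^-1)%:M + - (r^-1 *: Z) = r^-1 *: (Y - Z).
Proof. by rewrite mul_mx_scalar -scalerBr. Qed.

Lemma peval_zoom (R : realType) n (Z Y : 'rV[R]_n) (r S : R) (Q : mpoly n R) :
  peval (zoom Z r S Q) Y = S * peval Q (r^-1 *: (Y - Z)).
Proof. by rewrite pevalZ peval_affcomp zoom_pre. Qed.

Lemma zoom_orthogonal (R : realType) n (r : R) :
  ((r^-1)%:M : 'M[R]_n)^T *m (r^-1)%:M = (r ^- 2)%:M.
Proof. by rewrite tr_scalar_mx -scalar_mxM -expr2 exprVn. Qed.

Lemma lap_zoom (R : realType) n (Z Y : 'rV[R]_n) (r S : R) (Q : mpoly n R) :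
  peval (lap (zoom Z r S Q)) Y = S / r ^+ 2 * peval (lap Q) (r^-1 *: (Y - Z)).
Proof.
by rewrite lapZ (lap_affcomp _ _ (@zoom_orthogonal R n r)) !pevalZ peval_affcomp zoom_pre mulrA.
Qed.

Lemma grad_zoom (R : realType) n (Z Y : 'rV[R]_n) (r S : R) (Q : mpoly n R) :
  0 < r -> 0 < S ->
  enorm (gradient (peval (zoom Z r S Q)) Y) =
  S / r * Num.sqrt (peval (grad_sqr Q) (r^-1 *: (Y - Z))).
Proof.
move=> r0 S0; rewrite enorm_gradient_peval grad_sqrZ.
rewrite (grad_sqr_affcomp _ _ (@zoom_orthogonal R n r)) !pevalZ peval_affcomp zoom_pre.
rewrite mulrA (_ : S ^+ 2 * r ^- 2 = (S / r) ^+ 2); last by rewrite exprMn exprVn.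
by rewrite sqrtrM ?sqr_ge0 // sqrtr_sqr gtr0_norm // divr_gt0.
Qed.

Lemma near_zoom (R : realType) n (Z x : 'rV[R]_n) (r : R) (P : set 'rV[R]_n) :
  0 < r -> (\forall y \near x, P y) ->
  \forall Y \near Z + r *: x, P (r^-1 *: (Y - Z)).
Proof.
move=> r0 /nbhs_enormP[e e0 he]; apply/nbhs_enormP; exists (r * e); first by rewrite mulr_gt0.
move=> Y Yx; apply: he.
have -> : r^-1 *: (Y - Z) - x = r^-1 *: (Y - (Z + r *: x)).
  by rewrite opprD addrA [in RHS]scalerBr scalerA mulVf ?gt_eqF // scale1r.
by rewrite enormZ gtr0_norm ?invr_gt0 // ltr_pdivrMl.
Qed.

Lemma zoomK (R : realType) n (Z x : 'rV[R]_n) (r : R) :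
  0 < r -> r^-1 *: (Z + r *: x - Z) = x.
Proof. by move=> r0; rewrite addrC addKr scalerA mulVf ?gt_eqF // scale1r. Qed.

Lemma unzoomK (R : realType) n (Z Y : 'rV[R]_n) (r : R) :
  0 < r -> Z + r *: (r^-1 *: (Y - Z)) = Y.
Proof. by move=> r0; rewrite scalerA divff ?gt_eqF // scale1r addrC subrK. Qed.

Lemma zoom_in_cball (R : realType) n (Z x : 'rV[R]_n) (r : R) :
  0 < r -> enorm x <= 1 -> cball Z r (Z + r *: x).
Proof.
by move=> r0 x1; rewrite /cball /= addrC addKr enormZ gtr0_norm // ler_piMr // ltW.
Qed.

Section Rescaling.
Variables (R : realType) (n : nat) (alpha beta c0 g : R).
Variables (O : set 'rV[R]_n) (f u w : 'rV[R]_n -> R) (Z : 'rV[R]_n) (r S : R).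
Hypotheses (c0_gt0 : 0 < c0) (f_bounds : forall X, O X -> c0 <= f X /\ f X <= c0^-1).
Hypothesis u_sol : viscosity_solution alpha beta f O u.
Hypotheses (r_gt0 : 0 < r) (S_gt0 : 0 < S) (ball_O : cball Z r `<=` O).
Hypothesis w_def : forall x : 'rV[R]_n, enorm x < 1 -> w x = u (Z + r *: x) / S.

Let near_ball (x : 'rV[R]_n) : enorm x < 1 -> \forall y \near x, enorm y < 1.
Proof.
move=> x1; apply/nbhs_enormP; exists (1 - enorm x); first by rewrite subr_gt0.
by move=> y yx; rewrite -(subrK x y); apply: le_lt_trans (enormD _ _) _; lra.
Qed.

Lemma rescaled_subsolution (Q : mpoly n R) (x : 'rV[R]_n) :
  enorm x < 1 -> local_max (fun y => w y - peval Q y) x ->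
  c0 <= (S * w x) `^ alpha * (S / r * Num.sqrt (peval (grad_sqr Q) x)) `^ beta
        * (S / r ^+ 2 * peval (lap Q) x).
Proof.
move=> x1 wmax; have xO := ball_O (zoom_in_cball Z r_gt0 (ltW x1)).
have [_ _ sub _] := u_sol.
have Sw y : enorm y < 1 -> S * w y = u (Z + r *: y).
  by move=> y1; rewrite w_def // mulrCA divff ?mulr1 // gt_eqF.
have := sub (Z + r *: x) (peval (zoom Z r S Q)) xO (C2_near_peval _ _).
rewrite laplacian_peval lap_zoom grad_zoom // zoomK // -Sw // => le.
apply: le_trans (f_bounds xO).1 (le _).
apply: filterS (near_zoom Z r_gt0 (filterI wmax (near_ball x1))) => Y [le1 Y1].
rewrite !peval_zoom zoomK // -Sw // -{1}(unzoomK Z Y r_gt0) -Sw // -!mulrBr.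
by rewrite ler_pM2l.
Qed.

Lemma rescaled_supersolution (Q : mpoly n R) (x : 'rV[R]_n) :
  enorm x < 1 -> local_min (fun y => w y - peval Q y) x ->
  (S * w x) `^ alpha * (S / r * Num.sqrt (peval (grad_sqr Q) x)) `^ beta
        * (S / r ^+ 2 * peval (lap Q) x) <= c0^-1.
Proof.
move=> x1 wmin; have xO := ball_O (zoom_in_cball Z r_gt0 (ltW x1)).
have [_ _ _ sup] := u_sol.
have Sw y : enorm y < 1 -> S * w y = u (Z + r *: y).
  by move=> y1; rewrite w_def // mulrCA divff ?mulr1 // gt_eqF.
have := sup (Z + r *: x) (peval (zoom Z r S Q)) xO (C2_near_peval _ _).
rewrite laplacian_peval lap_zoom grad_zoom // zoomK // -Sw // => le.
apply: le_trans (le _) (f_bounds xO).2.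
apply: filterS (near_zoom Z r_gt0 (filterI wmin (near_ball x1))) => Y [le1 Y1].
rewrite !peval_zoom zoomK // -Sw // -{1}(unzoomK Z Y r_gt0) -Sw // -!mulrBr.
by rewrite ler_pM2l.
Qed.

(** As [f] is positive, a test function touching from above has positive
    Laplacian whatever its gradient. *)
Lemma rescaled_subharmonic : subharmonic_in (eball 0 1) w.
Proof.
move=> Q x; rewrite /eball /= subr0 => x1 /(rescaled_subsolution x1) le.
rewrite leNgt; apply/negP => l0; move: le; apply/negP; rewrite -ltNge.
apply: le_lt_trans c0_gt0; rewrite mulr_ge0_le0 ?mulr_ge0 ?powR_ge0 //.
by rewrite mulr_ge0_le0 ?ltW // divr_gt0 // exprn_gt0.
Qed.

Hypotheses (g_gt1 : 1 < g) (g_eq : g * (1 + beta + alpha) = 2 + beta).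
Hypothesis w_gt0 : forall x, 0 < w x.

(** For [v = w `^ (1 / g)] the equation reads, up to constants,
    [|Dv| ^ beta * (v * Lap v + (g - 1) * |Dv| ^ 2) = f].  Where the slope is at
    least [b] the hypothesis makes the gradient term alone as large as the bound
    on [f], so the Laplacian cannot be positive. *)
Lemma rescaled_superharmonic (b : R) :
  0 < b ->
  (g - 1) ^+ 2 / 4 * c0 * (S `^ (1 + beta + alpha) / r `^ (2 + beta) * g `^ beta
     * b `^ (2 + beta)) >= 1 ->
  0 <= 2 + beta ->
  superharmonic_where_steep (eball 0 1) b (fun x => w x `^ g^-1).
Proof.
move=> b0 large beta2 p x; rewrite /eball /= subr0 => x1 vmin steep.
rewrite leNgt; apply/negP => lap_gt0.
have g1 : 1 < g := g_gt1; have g0 : 0 < g by lra.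
pose t := w x `^ g^-1; have t0 : 0 < t by exact: powR_gt0.
have tg : t `^ g = w x by rewrite -powRrM mulVf ?gt_eqF // powRr1 // ltW.
pose c := (g - 1) ^+ 2 / 8; have c_ge0 : 0 < c by rewrite divr_gt0 // exprn_gt0 // subr_gt0.
pose sg : mpoly n R := t^-1 *: (p - mpolyC n (peval p x)).
have sgE y : peval sg y = (peval p y - peval p x) / t.
  by rewrite pevalZ pevalD pevalN pevalC mulrC.
have sgx : peval sg x = 0 by rewrite sgE subrr mul0r.
(* A quadratic Taylor minorant of the g-th power turns the test function for
   the root into one for w. *)
pose Q : mpoly n R := w x *: (1 + g *: sg + c *: (sg * sg)).
have QE y : peval Q y = w x * (1 + g * peval sg y + c * peval sg y ^+ 2).
  by rewrite !(pevalZ, pevalD, peval1, pevalM) expr2.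
have wmin : local_min (fun y => w y - peval Q y) x.
  have [e e0 he] : exists2 e : R, 0 < e & e <= 1 /\ (g - 1) / (g + 1) <= 1 - e.
    exists (2 / (g + 1)); first by rewrite divr_gt0 //; lra.
    split; first by rewrite ler_pdivrMr; lra.
    rewrite (_ : 1 - _ = (g - 1) / (g + 1)) //; field.
    by rewrite gt_eqF //; lra.
  have cont : {for x, continuous (peval sg)} by exact: peval_continuous.
  have [d d0 hd] := (continuous_enormP _ _).1 cont e e0.
  have near_d : \forall y \near x, enorm (y - x) < d by apply/nbhs_enormP; exists d.
  apply: filterS (filterI vmin near_d) => y [le /hd].
  rewrite sgx subr0 ltr_norml => /andP[sl su].
  rewrite !QE sgx mulr0 expr0n /= mulr0 !addr0 mulr1 subrr subr_ge0.
  have le_t : t * (1 + peval sg y) <= w y `^ g^-1.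
    rewrite sgE mulrDr mulr1 mulrC divfK ?gt_eqF //; move: le; rewrite -/t; lra.
  have sy0 : 0 <= 1 + peval sg y by lra.
  have : (t * (1 + peval sg y)) `^ g <= w y.
    have -> : w y = (w y `^ g^-1) `^ g.
      by rewrite -powRrM mulVf ?gt_eqF // powRr1 // ltW.
    by apply: ge0_ler_powR; rewrite ?nnegrE ?powR_ge0 ?mulr_ge0 ?(ltW g0) ?(ltW t0).
  rewrite powRM ?(ltW t0) // tg; apply: le_trans; rewrite ler_wpM2l ?(ltW (w_gt0 x)) //.
  have := @powR_second_order R g (1 + peval sg y) g_gt1.
  by rewrite (addrC 1) addrK; apply; lra.
have gradsg i : mderiv i sg = t^-1 *: mderiv i p.
  by rewrite mderivZ mderivB mderivC subr0.
have gradsg_sqr : peval (grad_sqr sg) x = t ^- 2 * peval (grad_sqr p) x.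
  by rewrite !peval_sum mulr_sumr; apply: eq_bigr => i _; rewrite gradsg !pevalE; field;
      rewrite gt_eqF.
have lapsg : lap sg = t^-1 *: lap p by rewrite lapZ lapB lapC subr0.
clearbody sg.
have lapQ : peval (lap Q) x = w x * (g / t * peval (lap p) x + 2 * c * (t ^- 2 * peval
    (grad_sqr p) x)).
  rewrite lapZ pevalZ !lapD !lapZ lapM -/(grad_sqr sg) -(mpolyC1 n R) lapC add0r.
  rewrite lapsg !(pevalD, pevalZ, pevalM) sgx gradsg_sqr !pevalC.
  by congr (_ * _); field; rewrite gt_eqF.
have gradQ : peval (grad_sqr Q) x = (w x * g / t) ^+ 2 * peval (grad_sqr p) x.
  have -> : peval (grad_sqr Q) x = \sum_(i < n) (w x * g / t) ^+ 2 * (peval (mderiv i p) x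
      * peval (mderiv i p) x).
    rewrite peval_sum; apply: eq_bigr => i _; rewrite pevalM.
    have -> : peval (mderiv i Q) x = w x * g / t * peval (mderiv i p) x; last by ring.
    rewrite mderivZ !mderivD !mderivZ mderivM gradsg -(mpolyC1 n R) mderivC add0r.
    rewrite !(pevalZ, pevalD, pevalM) sgx; ring.
  by rewrite -mulr_sumr peval_sum; congr (_ * _); apply: eq_bigr => i _; rewrite pevalM.
have := rescaled_supersolution x1 wmin; rewrite lapQ gradQ.
set G := peval (grad_sqr p) x in steep *; have G0 : 0 <= G := grad_sqr_ge0 _ _.
have sqrtG : b <= Num.sqrt G.
  by rewrite -(ger0_norm (ltW b0)) -sqrtr_sqr ler_wsqrtr.
set h := Num.sqrt G in sqrtG *; have h0 : 0 < h by exact: lt_le_trans sqrtG.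
have GE : G = h ^+ 2 by rewrite /h sqr_sqrtr.
have -> : Num.sqrt ((w x * g / t) ^+ 2 * G) = w x * g / t * h.
  rewrite sqrtrM ?sqr_ge0 // sqrtr_sqr ger0_norm // divr_ge0 ?mulr_ge0 ?(ltW g0) ?(ltW t0) //.
  exact/ltW/w_gt0.
rewrite GE; set l := peval (lap p) x in lap_gt0 *; clearbody h.
set A := _ `^ alpha; set B := _ `^ beta.
have hom : A * B * (S / r ^+ 2 * (w x / t ^+ 2) * h ^+ 2) =
    S `^ (1 + beta + alpha) / r `^ (2 + beta) * g `^ beta * h `^ (2 + beta).
  by rewrite -(powR_homogeneity g_eq g0 S_gt0 r_gt0 t0 h0) tg /A /B (mulrA (S / r)).
have AB : 0 < A * B.
  by rewrite mulr_gt0 // powR_gt0 // !(mulr_gt0, divr_gt0, invr_gt0).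
have split_lap : A * B * (S / r ^+ 2 * (w x * (g / t * l + 2 * c * (t ^- 2 * h ^+ 2)))) =
    A * B * (S / r ^+ 2 * (w x * (g / t * l)))
    + 2 * c * (A * B * (S / r ^+ 2 * (w x / t ^+ 2) * h ^+ 2)) by ring.
rewrite split_lap hom; apply/negP; rewrite -ltNge.
have pos : 0 < A * B * (S / r ^+ 2 * (w x * (g / t * l))).
  apply: mulr_gt0 => //; apply: mulr_gt0; first by rewrite divr_gt0 ?exprn_gt0.
  by apply: mulr_gt0 => //; rewrite mulr_gt0 ?divr_gt0.
have mono : b `^ (2 + beta) <= h `^ (2 + beta).
  by rewrite ge0_ler_powR // nnegrE ltW.
set D := S `^ _ / _ * _ in large *.
have D0 : 0 <= D by rewrite !mulr_ge0 ?invr_ge0 ?powR_ge0.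
have cE : 2 * c = (g - 1) ^+ 2 / 4 by rewrite /c; field.
have low : c0^-1 <= 2 * c * (D * h `^ (2 + beta)).
  rewrite -[c0^-1]mul1r ler_pdivrMr // cE; apply: le_trans large _.
  have := ler_wpM2l D0 mono => /(ler_wpM2l (ltW c0_gt0)).
  have g8 : 0 <= (g - 1) ^+ 2 / 4 by rewrite divr_ge0 ?sqr_ge0.
  by move=> /(ler_wpM2l g8); lra.
lra.
Qed.
End Rescaling.

(** * Decay from one scale to the next *)

(** The radial retraction onto the closed unit ball.  Composing with it extends
    the rescaled solution continuously to the whole space. *)
Definition retract (R : realType) n (x : 'rV[R]_n) : 'rV[R]_n :=
  (Num.max 1 (enorm x))^-1 *: x.

Lemma retract_id (R : realType) n (x : 'rV[R]_n) : enorm x <= 1 -> retract x = x.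
Proof. by move=> x1; rewrite /retract max_l // invr1 scale1r. Qed.

Lemma enorm_retract (R : realType) n (x : 'rV[R]_n) : enorm (retract x) <= 1.
Proof.
have m0 : 0 < Num.max 1 (enorm x) by rewrite lt_max ltr01.
rewrite enormZ gtr0_norm ?invr_gt0 // ler_pdivrMl // mulr1.
by rewrite le_max lexx orbT.
Qed.

Lemma retract_continuous (R : realType) n : continuous (@retract R n).
Proof.
move=> x; pose m (y : 'rV[R]_n) : R^o := Num.max 1 (enorm y).
have cm : {for x, continuous m}.
  apply: (@continuous_max R _ (cst 1) (fun y : 'rV[R]_n => enorm y)); first exact: cst_continuous.
  have -> : (fun y : 'rV[R]_n => enorm y) = (fun y => enorm (y - 0)).
    by apply/funext => y; rewrite subr0.
  exact: enorm_continuous.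
have m0 : m x != 0 by rewrite gt_eqF // lt_max ltr01.
exact: (continuousZ (continuousV m0 cm) (@cvg_id _ (nbhs x))).
Qed.

(** With [C0] large, [C0 * r `^ g <= S] makes the slope threshold of the rescaled
    solution small enough for [small_near_zero], applied with the decay factor
    [(1 / 4) `^ g] of the growth to be proved. *)
Lemma decay_step (R : realType) n (alpha beta c0 g : R) :
  (0 < n)%N -> 0 < c0 -> 0 <= beta -> 0 < 1 + beta + alpha -> 1 < g ->
  g * (1 + beta + alpha) = 2 + beta ->
  exists (C0 eta : R), [/\ 0 < C0, 0 < eta &
    forall (O : set 'rV[R]_n) (f u : 'rV[R]_n -> R) (Z : 'rV[R]_n) (r S : R),
      open O -> (forall X, O X -> c0 <= f X /\ f X <= c0^-1) ->
      viscosity_solution alpha beta f O u ->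
      0 < r -> 0 < S -> cball Z r `<=` O -> (forall X, cball Z r X -> u X <= S) ->
      C0 * r `^ g <= S -> u Z <= eta * S ->
      forall X, cball Z (r / 4) X -> u X <= (1 / 4) `^ g * S].
Proof.
move=> n0 c0_gt0 beta0 p0 g1 g_eq; have g0 : 0 < g by lra.
have delta0 : 0 < (1 / 4) `^ g :> R by rewrite powR_gt0 // divr_gt0.
have delta1 : (1 / 4) `^ g <= 1 :> R.
  have q01 : ((0 : R) < 1 / 4) && ((1 / 4 : R) <= 1) by apply/andP; split; lra.
  by rewrite -[leRHS](powRr0 (1 / 4)); apply: ger_powR => //; exact: ltW.
have [b [eta [b0 eta0 small]]] := small_near_zero n0 delta0 delta1.
pose k := (g - 1) ^+ 2 / 4 * c0 * (g `^ beta * b `^ (2 + beta)).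
have k0 : 0 < k.
  by rewrite !mulr_gt0 ?powR_gt0 ?invr_gt0 // ?exprn_gt0 // subr_gt0.
have kE : k = (g - 1) ^+ 2 / 4 * c0 * (g `^ beta * b `^ (2 + beta)) by [].
clearbody k.
exists (k^-1 `^ (1 + beta + alpha)^-1), (eta `^ g).
split; rewrite ?powR_gt0 ?invr_gt0 //.
move=> O f u Z r S oO fO usol r0 S0 ZO uS Sr uZ X XZ.
have [cu upos _ _] := usol.
have inO x : O (Z + r *: retract x).
  by apply/ZO/zoom_in_cball => //; exact: enorm_retract.
pose w x := u (Z + r *: retract x) / S.
have w_gt0 x : 0 < w x by rewrite divr_gt0 ?upos ?inO.
have w1 x : w x <= 1.
  rewrite ler_pdivrMr // mul1r uS //; apply: zoom_in_cball => //; exact: enorm_retract.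
have cw : continuous w.
  have c1 : continuous (fun x : 'rV[R]_n => Z + r *: retract x).
    have cr : continuous (fun x : 'rV[R]_n => r *: retract x).
      move=> x; exact: (continuousZ (@cst_continuous 'rV[R]_n R^o r x) (@retract_continuous R n x)).
    by move=> x; exact: (continuousD (@cst_continuous 'rV[R]_n 'rV[R]_n Z x) (cr x)).
  have c2 : continuous (fun x : 'rV[R]_n => u (Z + r *: retract x)).
    move=> x; apply: (@continuous_comp _ _ _ (fun x => Z + r *: retract x) u); first exact: c1.
    by move: cu; rewrite continuous_open_subspace // => cu; apply/cu/mem_set/inO.
  by move=> x; exact: (continuousM (c2 x) (@cst_continuous 'rV[R]_n R^o S^-1 x)).
have w_def x : enorm x < 1 -> w x = u (Z + r *: x) / S.
  by move=> x1; rewrite /w retract_id // ltW.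
pose v x := w x `^ g^-1.
have gV0 : 0 < g^-1 by rewrite invr_gt0.
have v0 x : 0 <= v x by exact: powR_ge0.
have v1 x : v x <= 1.
  rewrite /v -[leRHS](congr1 (fun h => h g^-1) (powR1 R)).
  by apply: ge0_ler_powR; rewrite ?nnegrE ?(ltW gV0) ?(ltW (w_gt0 x)).
have wv x : w x <= v x.
  rewrite -{1}(powRr1 (ltW (w_gt0 x))); apply: ger_powR; first by rewrite w_gt0 w1.
  by rewrite invf_le1 // ltW.
have cv : continuous v.
  have cl : continuous (@ln R \o w).
    by move=> x; apply: continuous_comp; [exact: cw|exact: continuous_ln].
  have cgl : continuous (fun x => g^-1 * (@ln R \o w) x).
    by move=> x; exact: (continuousM (@cst_continuous 'rV[R]_n R^o g^-1 x) (cl x)).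
  have -> : v = @expR R \o (fun x => g^-1 * (@ln R \o w) x).
    by apply/funext => x; rewrite /v /powR gt_eqF.
  by move=> x; apply: continuous_comp; [exact: cgl|exact: continuous_expR].
have subw := rescaled_subharmonic c0_gt0 fO usol r0 S0 ZO w_def.
have superv : superharmonic_where_steep (eball 0 1) b v.
  apply: (rescaled_superharmonic c0_gt0 fO usol r0 S0 ZO w_def g1 g_eq w_gt0 b0); last lra.
  have -> : (g - 1) ^+ 2 / 4 * c0 * (S `^ (1 + beta + alpha) / r `^ (2 + beta) * g `^ beta
     * b `^ (2 + beta)) = k * (S `^ (1 + beta + alpha) / r `^ (2 + beta)) by rewrite kE; ring.
  rewrite mulrA ler_pdivlMr ?powR_gt0 // mul1r -ler_pdivrMl //.
  have <- : (k^-1 `^ (1 + beta + alpha)^-1 * r `^ g) `^ (1 + beta + alpha) = k^-1 * r `^ (2 + beta).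
    rewrite powRM ?powR_ge0 // -!powRrM g_eq mulVf ?gt_eqF // powRr1 // invr_ge0 ltW //.
  by apply: ge0_ler_powR; rewrite ?nnegrE ?(ltW p0) ?(ltW S0) // mulr_ge0 ?powR_ge0.
have v_center : v 0 <= eta.
  have : u Z / S <= eta `^ g by rewrite ler_pdivrMr.
  move=> le; rewrite -[leRHS](powRr1 (ltW eta0)) -(mulfV (lt0r_neq0 g0)) powRrM.
  rewrite /v w_def ?enorm0 // scaler0 addr0; apply: ge0_ler_powR;
      rewrite ?nnegrE ?(ltW gV0) ?powR_ge0 //.
  by rewrite divr_ge0 ?(ltW S0) // ltW // upos //; apply/ZO/cball_center/ltW.
have x4 : enorm (r^-1 *: (X - Z)) <= 1 / 4.
  by rewrite enormZ gtr0_norm ?invr_gt0 // ler_pdivrMl //; move: XZ; rewrite /cball /=; lra.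
have := small w v cw cv v0 v1 wv subw superv v_center _ x4.
rewrite w_def; last lra.
by rewrite unzoomK // ler_pdivrMr.
Qed.

(** The approximating solutions need not vanish at [Z], whence the margin [k] in
    the bound and the threshold [eta]. *)
Lemma limit_decay_step (R : realType) n (alpha beta g C0 eta : R)
    (O : set 'rV[R]_n) (f u0 : 'rV[R]_n -> R) (Z : 'rV[R]_n) (r S : R) :
  0 < eta -> 0 < g -> open O ->
  (forall u : 'rV[R]_n -> R, forall S : R, viscosity_solution alpha beta f O u ->
      0 < S -> (forall X, cball Z r X -> u X <= S) ->
      C0 * r `^ g <= S -> u Z <= eta * S ->
      forall X, cball Z (r / 4) X -> u X <= (1 / 4) `^ g * S) ->
  limiting_solution alpha beta f O u0 ->
  0 < r -> 0 < S -> cball Z r `<=` O -> u0 Z = 0 ->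
  (forall X, cball Z r X -> u0 X <= S) -> C0 * r `^ g <= S ->
  forall X, cball Z (r / 4) X -> u0 X <= (1 / 4) `^ g * S.
Proof.
move=> eta0 g0 oO step [_ _ [u [usol cvg_u]]] r0 S0 ZO uZ uS Sr X XZ.
have delta1 : (1 / 4) `^ g <= 1 :> R.
  have q01 : ((0 : R) < 1 / 4) && ((1 / 4 : R) <= 1) by apply/andP; split; lra.
  by rewrite -[leRHS](powRr0 (1 / 4)); apply: ger_powR => //; exact: ltW.
apply/ler_addgt0Pr => e e0.
pose k := Num.min (eta * S) (e / 2).
have k0 : 0 < k by rewrite lt_min !(mulr_gt0, divr_gt0).
have k_eta : k <= eta * S by rewrite ge_min lexx.
have k_e : k <= e / 2 by rewrite ge_min lexx orbT.
clearbody k.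
have unif : {uniform cball Z r, u @ \oo --> u0}.
  by move/fam_cvgP: cvg_u; apply; split=> //; exact: cball_compact.
have nb : nbhs (u0 : {uniform` cball Z r -> R^o})
    [set h | forall Y, cball Z r Y -> `|u0 Y - h Y| < k].
  apply/uniform_nbhs; exists [set p | ball p.1 k p.2]; split => //.
  by rewrite -entourage_ballE; exists k.
have ev : \forall j \near \oo, forall Y, cball Z r Y -> `|u0 Y - u j Y| < k := unif _ nb.
have [j uj] := filter_ex ev.
have uj_S X' : cball Z r X' -> u j X' <= S + k.
  by move=> XZ'; have := uj X' XZ'; have := uS X' XZ'; rewrite ltr_norml => ? /andP[]; lra.
have ujZ : u j Z <= eta * (S + k).
  have := uj Z (cball_center Z (ltW r0)); rewrite uZ ltr_norml => /andP[+ _].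
  by have : 0 <= eta * k by [rewrite mulr_ge0 ?ltW]; lra.
have Sk : 0 < S + k by rewrite addr_gt0.
have Cr : C0 * r `^ g <= S + k by rewrite (le_trans Sr) // lerDl ltW.
have := step (u j) (S + k) (usol j) Sk uj_S Cr ujZ X XZ.
have Xr : cball Z r X by move: XZ; rewrite /cball /=; lra.
have := uj X Xr; rewrite ltr_norml => /andP[_ +].
have : (1 / 4) `^ g * k <= k by rewrite ler_piMl // ltW.
lra.
Qed.

(** Decay by [(1 / 4) `^ g] at each division of the radius by 4 is growth of order
    [g]; the factor [4 `^ g] pays for the radii between two scales. *)
Lemma iterated_decay (R : realType) n (g rs C1 r : R) (u : 'rV[R]_n -> R) (Z : 'rV[R]_n) :
  0 < g -> 0 < r -> r <= rs -> 0 <= C1 ->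
  (forall X, cball Z rs X -> u X <= C1) ->
  (forall k, (forall X, cball Z (rs * (1 / 4) ^+ k) X -> u X <= C1 * ((1 / 4) `^ g) ^+ k) ->
    forall X, cball Z (rs * (1 / 4) ^+ k / 4) X -> u X <= (1 / 4) `^ g * (C1 * ((1 / 4) `^
        g) ^+ k)) ->
  forall X, cball Z r X -> u X <= C1 * (4 / rs) `^ g * r `^ g.
Proof.
move=> g0 r0 r_rs C1_ge0 base step X XZ; have rs0 : 0 < rs by exact: lt_le_trans r_rs.
have iter k : forall X, cball Z (rs * (1 / 4) ^+ k) X -> u X <= C1 * ((1 / 4) `^ g) ^+ k.
  elim: k => [|k IH] Y; first by rewrite !expr0 !mulr1; exact: base.
  move=> YZ; rewrite exprS mulrCA; apply: step => //.
  by move: YZ; rewrite exprS mulrCA mul1r mulrC.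
have q0 : (0 : R) < 1 / 4 by rewrite divr_gt0.
have ex : exists k, rs * (1 / 4) ^+ k.+1 < r.
  have : `|1 / 4 : R| < 1 by rewrite gtr0_norm //; lra.
  move=> /cvg_expr/cvgrPdist_lt/(_ (r / rs))[|k _ hk]; first by rewrite divr_gt0.
  exists k; have := hk k.+1 (leqnSn k); rewrite sub0r normrN gtr0_norm ?exprn_gt0 //.
  by rewrite ltr_pdivlMr // mulrC.
have [k kr kmin] := ex_minnP ex.
have r_k : r <= rs * (1 / 4) ^+ k.
  case: k kr kmin => [|k] kr kmin; first by rewrite expr0 mulr1.
  by rewrite leNgt; apply/negP => /kmin; rewrite ltnn.
apply: le_trans (iter k X _) _; first by move: XZ; rewrite /cball /=; lra.
have rs4 : 0 <= 4 / rs by rewrite divr_ge0 // ltW.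
have le_k : (1 / 4) ^+ k <= 4 / rs * r.
  by rewrite mulrAC ler_pdivlMr //; move: kr; rewrite exprS; lra.
rewrite -mulrA ler_wpM2l // -powRM ?(ltW r0) //.
rewrite -powR_mulrn ?powR_ge0 // powRAC powR_mulrn ?(ltW q0) //.
apply: ge0_ler_powR => //; rewrite ?nnegrE; first exact: ltW.
  by rewrite exprn_ge0 // ltW.
by rewrite mulr_ge0 // ltW.
Qed.

(** * Distances to boundaries *)

(** The crossing point is the last one reached from [Z] through a limit of
    points of [A]. *)
Lemma segment_meets_boundary (R : realType) n (A : set 'rV[R]_n) (Z Y : 'rV[R]_n) :
  A Z -> ~ A Y ->
  exists X, boundary A X /\ enorm (Z - Y) = enorm (Z - X) + enorm (X - Y).
Proof.
move=> AZ nAY; pose pt (t : R) := Z + t *: (Y - Z).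
have ptB s t : pt s - pt t = (s - t) *: (Y - Z).
  by rewrite /pt opprD addrACA subrr add0r scalerBl.
have pt0 : pt 0 = Z by rewrite /pt scale0r addr0.
have pt1 : pt 1 = Y by rewrite /pt scale1r addrC subrK.
pose T := [set t : R | 0 <= t <= 1 /\ A (pt t)].
have T0 : T 0 by split; [rewrite lexx ler01|rewrite pt0].
have ubT : ubound T 1 by move=> t [/andP[]].
have hsT : has_sup T by split; [exists 0|exists 1].
pose s := sup T; have s0 : 0 <= s by apply: ub_le_sup T0; exists 1.
have s1 : s <= 1 by apply: ge_sup => //; exists 0.
have YZ0 := enorm_ge0 (Y - Z).
exists (pt s); split; last first.
  have -> : Z - pt s = (0 - s) *: (Y - Z) by rewrite -ptB pt0.
  have -> : pt s - Y = (s - 1) *: (Y - Z) by rewrite -ptB pt1.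
  rewrite (enorm_distC Z) !enormZ sub0r normrN (ger0_norm s0) distrC ger0_norm ?subr_ge0 //; ring.
split.
- move=> B /nbhs_enormP[e e0 eB].
  have d0 : 0 < e / (enorm (Y - Z) + 1) by rewrite divr_gt0 // ltr_wpDl.
  have [t Tt lt] := sup_adherent d0 hsT.
  exists (pt t); split; first by have [] := Tt.
  have ts : t <= s by apply: ub_le_sup => //; exists 1.
  apply: eB; rewrite ptB enormZ ler0_norm ?subr_le0 // opprB.
  move: lt; rewrite -/s ltrBlDr -ltrBlDl ltr_pdivlMr ?ltr_wpDl // => lt.
  by have : 0 <= s - t by [rewrite subr_ge0]; lra.
- move=> /nbhs_enormP[e e0 eA].
  have As : A (pt s) by apply: eA; rewrite subrr enorm0.
  have s_lt : s < 1.
    by rewrite lt_neqAle s1 andbT; apply: contra_not_neq nAY => s1'; rewrite -pt1 -s1'.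
  pose d := Num.min (1 - s) (e / (enorm (Y - Z) + 1) / 2).
  have d0 : 0 < d by rewrite lt_min subr_gt0 s_lt !divr_gt0 // ltr_wpDl.
  have d1 : d <= 1 - s by rewrite ge_min lexx.
  have de : d <= e / (enorm (Y - Z) + 1) / 2 by rewrite ge_min lexx orbT.
  have : T (s + d).
    split; first by apply/andP; split; lra.
    apply: eA; rewrite ptB enormZ addrC addKr gtr0_norm //.
    have := ler_wpM2r YZ0 de; move/le_lt_trans; apply.
    rewrite mulrAC ltr_pdivrMr // mulrAC ltr_pdivrMr ?ltr_wpDl //; nra.
  by move=> /(ub_le_sup (ex_intro _ 1 ubT)); rewrite -/s; lra.
Qed.

Lemma compact_ball_sub_open (R : realType) n (K O : set 'rV[R]_n) :
  compact K -> open O -> K `<=` O ->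
  exists2 e : R, 0 < e & forall y z, K y -> enorm (y - z) < e -> O z.
Proof.
move=> /compact_near_coveringP cov oO KO.
pose P (d : R) (y : 'rV[R]_n) := forall z, enorm (y - z) < d -> O z.
have near0 : \forall d \near 0^'+, K `<=` P d.
  apply: cov => y Ky.
  have /nbhs_enormP[d d0 hd] : nbhs y O by apply: open_nbhs_nbhs; split => //; exact: KO.
  have dh : 0 < d / 2 by rewrite divr_gt0.
  exists (eball y (d / 2), [set t | t < d / 2]).
    split=> /=; first by apply/nbhs_enormP; exists (d / 2).
    exact: nbhs_right_lt.
  move=> [x t] /= [xy td] z xz; rewrite /eball /= in xy; apply: hd.
  by have tri := enorm_triangle z x y; rewrite (enorm_distC z x) in tri; lra.
have ev : \forall d \near 0^'+, 0 < d /\ K `<=` P d.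
  by apply: filterI near0; exact: nbhs_right_gt.
have [d [d0 hd]] := filter_ex ev.
by exists d => // y z /hd; exact.
Qed.

Lemma boundary_open_out (T : topologicalType) (O : set T) (X : T) :
  open O -> boundary O X -> ~ O X.
Proof. by move=> oO [_ nX] /= OX; apply: nX; rewrite (interior_id _).1. Qed.

Lemma set_dist_le (R : realType) n (A B : set 'rV[R]_n) X Y :
  A X -> B Y -> (set_dist A B <= (enorm (X - Y))%:E)%E.
Proof. by move=> AX BY; apply: ereal_inf_lbound; exists X => //; exists Y. Qed.

(** Leaving [O] from [Z] one first crosses the boundary of [O'], then that of
    [O]; so the distance of these boundaries bounds from below the distance of
    [Z] to the complement of [O]. *)
Lemma cball_sub_of_boundary_dist (R : realType) n (O O' : set 'rV[R]_n) (Z : 'rV[R]_n) (r : R) :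
  open O -> closure O' `<=` O -> O' Z ->
  (r%:E < set_dist (boundary O') (boundary O))%E -> cball Z r `<=` O.
Proof.
move=> oO O'O O'Z rd Y ZY; apply: contrapT => nOY.
have nO'Y : ~ O' Y by move=> /subset_closure/O'O.
have [X1 [bX1 E1]] := segment_meets_boundary O'Z nO'Y.
have OX1 : O X1 by apply: O'O; have [] := bX1.
have [X2 [bX2 E2]] := segment_meets_boundary OX1 nOY.
have := lt_le_trans rd (set_dist_le bX1 bX2); rewrite lte_fin.
move: ZY; rewrite /cball /= (enorm_distC Y Z) E1 E2.
by have := enorm_ge0 (Z - X1); have := enorm_ge0 (X2 - Y); lra.
Qed.

Lemma eball_sub_of_boundary_dist (R : realType) n (O' : set 'rV[R]_n) (Z : 'rV[R]_n) (r : R) :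
  O' Z -> (r%:E < set_dist [set Z] (boundary O'))%E -> eball Z r `<=` O'.
Proof.
move=> O'Z rd Y ZY; apply: contrapT => nO'Y.
have [X [bX E]] := segment_meets_boundary O'Z nO'Y.
have := lt_le_trans rd (set_dist_le (erefl Z : [set Z] Z) bX); rewrite lte_fin.
move: ZY; rewrite /eball /= (enorm_distC Y Z) E.
by have := enorm_ge0 (X - Y); lra.
Qed.

Lemma boundary_dist_gt0 (R : realType) n (O O' : set 'rV[R]_n) :
  open O -> compactly_contained O' O ->
  (0 < set_dist (boundary O') (boundary O))%E.
Proof.
move=> oO [cO' O'O]; have [e e0 he] := compact_ball_sub_open cO' oO O'O.
apply: (@lt_le_trans _ _ e%:E); first by rewrite lte_fin.
apply: le_ereal_inf_tmp => _ [X [cX _] [Y bY <-]]; rewrite lee_fin leNgt.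
by apply/negP => /(he _ _ cX); exact: boundary_open_out.
Qed.

Lemma boundary_rV0 (R : realType) (A : set 'rV[R]_0) Z : ~ boundary A Z.
Proof.
move=> [cA nA]; apply: nA; apply/nbhs_enormP; exists 1 => // y _.
have [x [Ax _]] := cA setT filterT.
by rewrite (_ : y = x) //; apply/rowP => - [].
Qed.

Lemma zero_on_free_boundary (R : realType) n (O : set 'rV[R]_n) (u : 'rV[R]_n -> R) Z :
  open O -> {within O, continuous u} -> (forall X, O X -> 0 <= u X) -> O Z ->
  boundary (positivity_set O u) Z -> u Z = 0.
Proof.
move=> oO cu u0 OZ [_ nint]; apply/eqP; rewrite eq_le u0 // andbT leNgt.
apply/negP => uZ; apply: nint.
move: cu; rewrite continuous_open_subspace // => cu.
have [d d0 hd] := (continuous_enormP u Z).1 (cu Z (mem_set OZ)) _ uZ.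
have [e e0 he] := (nbhs_enormP Z O).1 (open_nbhs_nbhs (conj oO OZ)).
apply/nbhs_enormP; exists (Num.min d e); first by rewrite lt_min d0.
move=> y; rewrite lt_min => /andP[yd ye]; split; first exact: he.
by have := hd y yd; rewrite ltr_norml => /andP[+ _]; lra.
Qed.

(** * Growth at the free boundary *)

Theorem theorem2 (R : realType) (n : nat) (alpha beta c0 : R)
    (sigma : R -> R) (M : R) (d : \bar R) :
  0 <= beta -> - (1 + beta) < alpha -> alpha < 1 -> 0 < c0 ->
  modulus_of_continuity sigma ->
  exists C : R, 1 <= C /\
    forall (O O' : set 'rV[R]_n) (f u0 : 'rV[R]_n -> R),
      domain O ->
      has_modulus O sigma f ->
      (forall X, O X -> c0 <= f X /\ f X <= c0^-1) ->
      limiting_solution alpha beta f O u0 ->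
      sup_norm O u0 = M%:E ->
      domain O' -> compactly_contained O' O ->
      set_dist (boundary O') (boundary O) = d ->
      forall Z : 'rV[R]_n,
        (boundary (positivity_set O u0) `&` O') Z ->
        forall r : R, 0 < r ->
          (r%:E < set_dist [set Z] (boundary O'))%E ->
          (ereal_sup [set (u0 X)%:E | X in eball Z r]
            <= (C * r `^ ((2 + beta) / (1 + beta + alpha)))%:E)%E.
Proof.
move=> beta0 alpha_lo alpha1 c0_gt0 _.
have [n0|n0] := posnP n.
  by subst n; exists 1; split => // O O' f u0 _ _ _ _ _ _ _ _ Z [/boundary_rV0].
have p0 : 0 < 1 + beta + alpha by lra.
set g := (2 + beta) / (1 + beta + alpha).
have g1 : 1 < g by rewrite /g ltr_pdivlMr //; lra.
have g_eq : g * (1 + beta + alpha) = 2 + beta by rewrite /g divfK // gt_eqF.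
clearbody g; have g0 : 0 < g by lra.
have [C0 [eta [C0_gt0 eta0 step]]] := decay_step n0 c0_gt0 beta0 p0 g1 g_eq.
(* Balls of radius rs about points of O' lie in O, by
   cball_sub_of_boundary_dist, once d is known to be positive. *)
have [rs [rs0 rs_d]] : exists rs : R, 0 < rs /\ ((0 < d)%E -> (rs%:E < d)%E).
  case: d => [t| |]; [|by exists 1; split; rewrite // => _; exact: ltry|by exists 1].
  have [t0|t0] := ltP 0 t; last by exists 1; split => //; rewrite lte_fin ltNge t0.
  by exists (t / 2); split; [rewrite divr_gt0|rewrite !lte_fin => _; lra].
pose C1 := Num.max 1 (Num.max M (C0 * rs `^ g)).
have C1_1 : 1 <= C1 by rewrite le_max lexx.
have C1_M : M <= C1 by rewrite !le_max lexx !orbT.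
have C1_C0 : C0 * rs `^ g <= C1 by rewrite !le_max lexx !orbT.
clearbody C1.
pose C := C1 * (4 / rs) `^ g.
exists (Num.max 1 C); split; first by rewrite le_max lexx.
move=> O O' f u0 [oO _ _] _ fO lim normu _ cO' distd Z [bZ O'Z] r r0 r_lt.
have [cu u_ge0 _] := lim.
have O'O : O' `<=` O by move=> X /subset_closure; apply: cO'.2.
have u_M X : O X -> u0 X <= M.
  move=> OX; rewrite -lee_fin -normu; apply: (@le_trans _ _ `|u0 X|%:E).
    by rewrite lee_fin ler_norm.
  by apply: ereal_sup_ubound; exists X.
have uZ : u0 Z = 0 := zero_on_free_boundary oO cu u_ge0 (O'O _ O'Z) bZ.
have rs_O : cball Z rs `<=` O.
  apply: (cball_sub_of_boundary_dist oO cO'.2 O'Z); rewrite distd; apply: rs_d.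
  by rewrite -distd; exact: boundary_dist_gt0.
apply: ge_ereal_sup => _ [X XZ <-]; rewrite lee_fin.
have OX : O X by apply/O'O/(eball_sub_of_boundary_dist O'Z r_lt).
apply: (@le_trans _ _ (C * r `^ g)); last first.
  by rewrite ler_wpM2r ?powR_ge0 // le_max lexx orbT.
have [r_rs|rs_r] := leP r rs; last first.
  apply: le_trans (u_M X OX) _; apply: le_trans C1_M _.
  rewrite /C -mulrA ler_peMr //; first lra.
  rewrite -powRM ?divr_ge0 ?(ltW r0) ?(ltW rs0) //.
  rewrite -[leLHS](congr1 (fun h => h g) (powR1 R)).
  apply: ge0_ler_powR; rewrite ?nnegrE ?(ltW g0) //.
    by rewrite mulr_ge0 ?divr_ge0 ?(ltW r0) ?(ltW rs0).
  by rewrite mulrAC ler_pdivlMr //; lra.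
apply: (iterated_decay (Z := Z) g0 r0 r_rs) => //.
- lra.
- by move=> Y YZ; apply: le_trans (u_M _ (rs_O _ YZ)) C1_M.
- move=> k IH.
  have q0 : (0 : R) < 1 / 4 by rewrite divr_gt0.
  have rk0 : 0 < rs * (1 / 4) ^+ k by rewrite mulr_gt0 ?exprn_gt0.
  have rk_rs : rs * (1 / 4) ^+ k <= rs.
    by rewrite ler_piMr ?(ltW rs0) // exprn_ile1 //; lra.
  have rk_O : cball Z (rs * (1 / 4) ^+ k) `<=` O.
    by move=> Y YZ; apply: rs_O; apply: le_trans YZ rk_rs.
  have Sk0 : 0 < C1 * ((1 / 4) `^ g) ^+ k.
    by rewrite mulr_gt0 ?exprn_gt0 ?powR_gt0 //; lra.
  have step_u u S (usol : viscosity_solution alpha beta f O u) (S0 : 0 < S) :=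
    step O f u Z _ S oO fO usol rk0 S0 rk_O.
  apply: (limit_decay_step eta0 g0 oO step_u lim rk0 Sk0 rk_O uZ IH).
  rewrite powRM ?(ltW rs0) ?exprn_ge0 ?(ltW q0) //.
  rewrite -[(1 / 4) ^+ k]powR_mulrn ?(ltW q0) // powRAC powR_mulrn ?powR_ge0 //.
  by rewrite mulrA ler_wpM2r ?exprn_ge0 ?powR_ge0.
- by move: XZ; rewrite /eball /cball /= => /ltW.
Qed.
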